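(* Let $k\ge2$, let $\mathcal H$ be a separable Hilbert space, $M>0$, and assume that the probability distribution $P$ on $\mathcal H$ satisfies a margin condition with radius $r_0>0$ (in particular $P$ is $M$-bounded). Then: (i) For every $\mathbf c^*\in\mathcal M$ and $\mathbf c\in\mathcal B(0,M)^k$, if $\|\mathbf c-\mathbf c^*\|\le\frac{Br_0}{4\sqrt2M}$, then $$\ell(\mathbf c,\mathbf c^* )\ge\frac{p_{\min}}2\|\mathbf c-\mathbf c^*\|^2 .$$ (ii) $\mathcal M$ is finite. (iii) There exists $\varepsilon>0$ such that $P$ is $\varepsilon$-separated. (iv) With this $\varepsilon$, for all $\mathbf c\in\mathcal B(0,M)^k$, $$\frac1{16M^2}\operatorname{Var}\left(\gamma(\mathbf c,\cdot)-\gamma(\mathbf c^*(\mathbf c),\cdot)\right)\le\|\mathbf c-\mathbf c^*(\mathbf c)\|^2\le\kappa_0\,\ell(\mathbf c,\mathbf c^* ),$$ where $\kappa_0=4kM^2\left(\frac1\varepsilon\vee\frac{64M^2}{p_{\min}B^2r_0^2}\right)$, $\mathbf c^*(\mathbf c)\in\arg\min_{\mathbf c^*\in\mathcal M}\|\mathbf c-\mathbf c^*\|$, and the variance is taken under $P$.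
   Context: Codebooks are $\mathbf c=(c_1,\dots,c_k)\in\mathcal H^k$, with norm $\|\mathbf c\|^2=\sum_i\|c_i\|^2$. For a probability distribution $P$ on $\mathcal H$, $Pf$ denotes the integral of $f$ with respect to $P$. $P$ is called $M$-bounded if its support is included in the closed ball $\mathcal B(0,M)$. It is a standing assumption that the support of $P$ contains more than $k$ points. Contrast function: $\gamma(\mathbf c,x)=\min_{j}\|x-c_j\|^2$. Risk: $R(\mathbf c)=P\gamma(\mathbf c,\cdot)$. $\mathcal M$ is the set of optimal codebooks, i.e. minimizers of $R$ over $\mathcal H^k$ (nonempty when $P$ is $M$-bounded); $\mathbf c^*$ denotes an element of $\mathcal M$, and $\ell(\mathbf c,\mathbf c^* )=R(\mathbf c)-R(\mathbf c^* )$ (independent of the choice of $\mathbf c^*\in\mathcal M$). Voronoi cells: $V_i(\mathbf c)=\{x\in\mathcal H:\ \forall j\ne i,\ \|x-c_i\|\le\|x-c_j\|\}$. $$B=\inf_{\mathbf c^*\in\mathcal M,\ i\ne j}\|c_i^*-c_j^*\|,\qquad p_{\min}=\inf_{\mathbf c^*\in\mathcal M,\ i=1,\dots,k}P(V_i(\mathbf c^* )).$$ For $\mathbf c^*\in\mathcal M$, $N_{\mathbf c^*}=\bigcup_{i\ne j}V_i(\mathbf c^* )\cap V_j(\mathbf c^* )$. For $A\subset\mathcal H$, $\mathcal B(A,t)=\bigcup_{a\in A}\mathcal B(a,t)$ (union of closed balls of radius $t$). For $t\ge0$, $p(t)=\sup_{\mathbf c^*\in\mathcal M}P(\mathcal B(N_{\mathbf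 c^*},t))$. Margin condition with radius $r_0>0$: (i) $P$ is $M$-bounded; (ii) for all $0\le t\le r_0$, $p(t)\le\frac{B\,p_{\min}}{128M^2}\,t$. Separation: let $\tilde{\mathcal M}$ be the set of local minimizers of $\mathbf c\mapsto P\gamma(\mathbf c,\cdot)$ on $\mathcal H^k$. For $\varepsilon>0$, $P$ is $\varepsilon$-separated if $\inf_{\mathbf c\in\tilde{\mathcal M}\setminus\mathcal M}\ell(\mathbf c,\mathbf c^* )=\varepsilon$. *)

(* Defs.v *)
From HB Require Import structures.
From mathcomp Require Export all_boot all_order all_algebra.
From mathcomp Require Export all_classical all_reals all_analysis.
Import Order.TTheory GRing.Theory Num.Theory numFieldNormedType.Exports.

Set Implicit Arguments.
Unset Strict Implicit.
Unset Printing Implicit Defensive.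

Local Open Scope classical_set_scope.
Local Open Scope ring_scope.

(* [inf] and [sup] of real sets are total and return 0 on sets that are empty
   or unbounded on the relevant side. For an M-bounded P whose support has more
   than k >= 2 points, every set to which they are applied below is nonempty
   and bounded; likewise the contrast is bounded on the support of P, so
   that the real-valued integral [risk] is the integral P gamma(c, .). *)

(* H with its Borel sigma-algebra *)
Definition borel (R : realType) (H : normedModType R) :=
  g_sigma_algebraType (@open H).

Definition separable (T : topologicalType) :=
  exists D : set T, countable D /\ dense D.

Section vector_quantization.
Context {R : realType} {H : normedModType R} {k : nat}.
Implicit Types (P : probability (borel H) R) (c : 'I_k -> H).

Definition measure_support P : set H :=
  [set x | forall U : set H, open U -> U x -> (0 < P U)%E].

Definition M_bounded (M : R) P :=
  measure_support P `<=` closed_ball_ Num.norm 0 M.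

Definition codebook_norm c : R := Num.sqrt (\sum_(i < k) `|c i| ^+ 2).

(* gamma(c, x); the minimum over j, as k > 0 *)
Definition contrast c (x : H) : R :=
  inf [set `|x - c j| ^+ 2 | j in [set: 'I_k]].

Definition risk P c : R := Rintegral P setT (contrast c).

Definition optimal P : set ('I_k -> H) :=
  [set c | forall c', risk P c <= risk P c'].

Definition local_minimizer P : set ('I_k -> H) :=
  [set c | exists2 delta : R, 0 < delta &
     forall c', codebook_norm (c' - c) < delta -> risk P c <= risk P c'].

Definition loss P c cstar : R := risk P c - risk P cstar.

Definition voronoi c (i : 'I_k) : set H :=
  [set x | forall j, j != i -> `|x - c i| <= `|x - c j|].

Definition min_dist P : R :=
  inf [set d | exists cstar i j,
    [/\ optimal P cstar, i != j & d = `|cstar i - cstar j|]].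

Definition p_min P : R :=
  inf [set p | exists cstar i,
    optimal P cstar /\ p = fine (P (voronoi cstar i))].

Definition boundary c : set H :=
  \bigcup_(ij in [set ij : 'I_k * 'I_k | ij.1 != ij.2])
    (voronoi c ij.1 `&` voronoi c ij.2).

(* [closed_ball_] rather than [closed_ball]: the latter is empty at radius 0 *)
Definition enlargement (A : set H) (t : R) : set H :=
  \bigcup_(a in A) closed_ball_ Num.norm a t.

Definition p_margin P (t : R) : R :=
  sup [set fine (P (enlargement (boundary cstar) t)) | cstar in optimal P].

Definition margin_condition (M r0 : R) P :=
  M_bounded M P /\
  forall t, 0 <= t <= r0 ->
    p_margin P t <= min_dist P * p_min P / (128 * M ^+ 2) * t.

(* Intended for eps > 0: the equality then forces the set to be nonempty. *)
Definition eps_separated (eps : R) P :=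
  inf [set l | exists c cstar,
    [/\ (local_minimizer P `\` optimal P) c, optimal P cstar
      & l = loss P c cstar]] = eps.

Definition nearest_optimal P c : set ('I_k -> H) :=
  [set cstar | optimal P cstar /\ forall c', optimal P c' ->
     codebook_norm (c - cstar) <= codebook_norm (c - c')].

Definition in_ball (M : R) c := forall i, closed_ball_ Num.norm 0 M (c i).

End vector_quantization.

(* k is not determined by P in the notions below *)
Arguments optimal {R H} k P.
Arguments min_dist {R H} k P.
Arguments p_min {R H} k P.
Arguments margin_condition {R H} k M r0 P.
Arguments eps_separated {R H} k eps P.
Arguments p_margin {R H} k P t.

(* Main.v *)
Require Import Defs.
From HB Require Import structures.
From mathcomp Require Import all_boot all_order all_algebra.
From mathcomp Require Import all_classical all_reals all_analysis.
From mathcomp Require Import measurable_realfun ring lra.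
Import Order.TTheory GRing.Theory Num.Theory numFieldNormedType.Exports.

(** Why the theorem holds. Below, c denotes a codebook, d an optimal one, rho
    the optimal risk with k - 1 centres, and pm, B, r0 are as in the statement.

    Compactness. Since the support has more than k points, rho exceeds the
    optimal risk with k centres. Deleting a centre costs at most 4 M^2 on its
    cell, so a codebook of risk below rho has cells of mass bounded below
    ([cell_mass_lb]); in the same way the centres of an optimal codebook are
    well separated, so B and pm are positive. Replacing each centre by the
    centroid of its cell (Lloyd's step) does not raise the risk, and the
    centroids of sets of mass bounded below form a totally bounded subset of H
    ([heavy_centroids_approx]). So minimizing sequences can be replaced by
    strongly converging ones, even in infinite dimension ([heavy_min]); this
    gives optimal codebooks, by induction on the number of centres
    ([optimal_exists]).

    The local inequality. The centres of d are the centroids of its cells, so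
    if points keep the cells of d but are represented by the centres of c, the
    risk of d is exceeded by the sum of P(V_i(d)) |c_i - d_i|^2, which is at
    least pm |c - d|^2. The true risk of c is smaller, but only because of the
    points that c and d assign differently. These are at distance at most
    2 sqrt 2 M |c - d| / B from the boundary of the cells of d
    ([boundary_near]), each of them contributes at most 4 sqrt 2 M |c - d|, and
    the margin condition bounds their mass; in total they contribute at most
    pm |c - d|^2 / 8 ([disagreement_cost]). This proves (i) with 7/8 in place of
    1/2, up to the distance r = B r0 / (4 sqrt 2 M). If c is itself stationary,
    as local minimizers are, the roles of c and d can be exchanged, which is
    possible only if c = d ([stationary_close]).

    Consequences. Optimal codebooks are thus at mutual distance at least r in a
    precompact set, so they are finitely many. Local minimizers that are not
    optimal stay at distance r from the optimal ones, and by precompactness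
    their loss is bounded below; they exist, since k - 1 optimal
    centres and a remote one form such a local minimizer
    ([far_local_minimizer]). Hence eps is positive, and at most the gap between
    rho and the optimal risk.

    Part (iv). Within distance r the local inequality suffices. In the outer
    region the loss is at least min(eps, pm r^2 / 2): otherwise, minimize the
    risk there. On the straight path of Lloyd's step the risk decreases, so the
    path cannot cross the spheres of radius r around optimal codebooks, where
    the loss is too large ([lloyd_outside]); this keeps the minimization within
    a precompact set. The minimizer is interior, hence a local minimizer of loss
    below eps that is not optimal, a contradiction ([outside_loss]). *)

Set Implicit Arguments.
Unset Strict Implicit.

Local Open Scope classical_set_scope.
Local Open Scope ring_scope.

(** * Hilbert space geometry and minimization *)

Section minimizing_filter.
Context {R : realType} {T : Type}.
Implicit Types (A : set T) (f : T -> R).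

Definition minimizing_filter A f : set_system T :=
  [set S | exists2 e, 0 < e & [set x | A x /\ f x < inf (f @` A) + e] `<=` S].

Lemma sublevel_nonempty A f (e : R) : has_inf (f @` A) -> 0 < e ->
  exists2 x, A x & f x < inf (f @` A) + e.
Proof.
by move=> iA e0; have [_ [x Ax <-] fx] := inf_adherent e0 iA; exists x.
Qed.

Lemma minimizing_filter_proper A f : has_inf (f @` A) ->
  ProperFilter (minimizing_filter A f).
Proof.
move=> iA; split.
  by case=> e e0 sub; have [x Ax fx] := sublevel_nonempty iA e0; exact: (sub x).
split; first by exists 1.
  move=> S U [e e0 sS] [d d0 sU]; exists (Num.min e d); first by rewrite lt_min e0.
  move=> x [Ax fx]; split; [apply: sS|apply: sU]; split => //;
    by apply: lt_le_trans fx _; rewrite lerD2l ge_min lexx ?orbT.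
by move=> S U SU [e e0 sS]; exists e => // x /sS /SU.
Qed.

End minimizing_filter.

Section hilbert.
Context {R : realType} {H : completeNormedModType R} {dot : {dot H for idfun}}.
Hypothesis dot_norm : forall x : H, dot x x = `|x| ^+ 2.
Implicit Types (x y z : H) (C : set H).

Lemma dotC x y : dot x y = dot y x.
Proof. by rewrite hermC expr0 mul1r. Qed.

Lemma dotDl x y z : dot (x + y) z = dot x z + dot y z.
Proof. exact: linearDl. Qed.

Lemma dotBl x y z : dot (x - y) z = dot x z - dot y z.
Proof. exact: linearBl. Qed.

Lemma dotZl (s : R) x y : dot (s *: x) y = s * dot x y.
Proof. by rewrite linearZl_LR. Qed.

Lemma dotDr x y z : dot z (x + y) = dot z x + dot z y.
Proof. by rewrite dotC dotDl !(dotC z). Qed.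

Lemma dotBr x y z : dot z (x - y) = dot z x - dot z y.
Proof. by rewrite dotC dotBl !(dotC z). Qed.

Lemma dotZr (s : R) x y : dot y (s *: x) = s * dot y x.
Proof. by rewrite dotC dotZl (dotC x). Qed.

Definition dotE := (dotBl, dotBr, dotDl, dotDr, dotZl, dotZr).

Lemma sqr_normB x y : `|x - y| ^+ 2 = `|x| ^+ 2 - 2 * dot x y + `|y| ^+ 2.
Proof. by rewrite -!dot_norm !dotE (dotC y x); ring. Qed.

Lemma sqr_normD x y : `|x + y| ^+ 2 = `|x| ^+ 2 + 2 * dot x y + `|y| ^+ 2.
Proof. by rewrite -!dot_norm !dotE (dotC y x); ring. Qed.

Lemma cauchy_schwarz x y : `|dot x y| <= `|x| * `|y|.
Proof.
have h0 z : 0 <= dot z z by rewrite dot_norm sqr_ge0.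
have key u v : `|u| = 1 -> dot u v <= `|v|.
  move=> u1; have := h0 (v - dot u v *: u).
  rewrite !dotE !dot_norm u1 (dotC v u) => h.
  have h2 : dot u v ^+ 2 <= `|v| ^+ 2 by nra.
  have [|/ltW d0] := leP (dot u v) 0; first by move=> /le_trans; exact.
  by rewrite -(@ler_pXn2r _ 2) ?nnegrE.
have key2 u v : dot u v <= `|u| * `|v|.
  have [->|u0] := eqVneq u 0.
    by rewrite normr0 mul0r -(scale0r 0) dotZl mul0r.
  have n0 : 0 < `|u| by rewrite normr_gt0.
  have := key (`|u|^-1 *: u) v.
  rewrite normrZ ger0_norm ?invr_ge0// mulVf ?gt_eqF// => /(_ erefl).
  by rewrite dotZl mulrC ler_pdivrMr// mulrC.
rewrite ler_norml key2 andbT.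
have := key2 (- x) y; rewrite -scaleN1r dotZl normrZ normrN1; lra.
Qed.

Lemma sqr_norm_mid x y z :
  `|x - 2^-1 *: (y + z)| ^+ 2 =
  (`|x - y| ^+ 2 + `|x - z| ^+ 2) / 2 - 4^-1 * `|y - z| ^+ 2.
Proof.
by rewrite -!dot_norm !dotE (dotC y x) (dotC z x) (dotC z y); field.
Qed.

(** Midpoint uniform convexity makes the sublevel sets of f near its infimum
    shrink, so the filter they generate is Cauchy. It serves twice: for the
    distance to a point (projections) and for the moment of inertia of a set
    about a variable point (centroids). *)
Lemma uniformly_convex_min C (f : H -> R) (a : R) : closed C -> C !=set0 ->
  0 < a -> continuous f -> (forall x, C x -> 0 <= f x) ->
  (forall x y, C x -> C y -> C (2^-1 *: (x + y)) /\
     f (2^-1 *: (x + y)) <= (f x + f y) / 2 - a * `|x - y| ^+ 2) ->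
  exists2 x, C x & forall y, C y -> f x <= f y.
Proof.
move=> Ccl C0 a0 fcont f0 fmid.
pose m := inf (f @` C).
have lbm : has_inf (f @` C).
  split; first by case: C0 => x Cx; exists (f x), x.
  by exists 0 => _ [x Cx <-]; exact: f0.
have mle x : C x -> m <= f x by move=> Cx; apply: ge_inf; [exact: lbm.2|exists x].
pose S e := [set x | C x /\ f x < m + e].
pose F := minimizing_filter C f.
have S0 e : 0 < e -> S e !=set0.
  by move=> e0; have [x Cx fx] := sublevel_nonempty lbm e0; exists x.
have FF : ProperFilter F by exact: minimizing_filter_proper.
have Fcauchy : cauchy F.
  apply: cauchy_exP => e e0.
  have e'0 : 0 < a * e ^+ 2 by rewrite mulr_gt0 ?exprn_gt0.
  have [x Sx] := S0 _ e'0; exists x.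
  exists (a * e ^+ 2) => // y Sy.
  rewrite -ball_normE /ball_ /=.
  have [Cm fm] := fmid _ _ Sx.1 Sy.1.
  have := mle _ Cm; have := Sx.2; have := Sy.2 => /= h1 h2 h3.
  have : a * `|x - y| ^+ 2 < a * e ^+ 2 by lra.
  by rewrite ltr_pM2l// ltr_pXn2r ?nnegrE ?(ltW e0)//.
have Fp : F --> lim F by exact: cauchy_cvg.
set p := lim F in Fp.
have Cp : C p.
  apply: Ccl => B /Fp [e e0 sB]; have [x Sx] := S0 _ e0.
  by exists x; split; [exact: Sx.1|exact: sB].
exists p => // y Cy; apply: le_trans (mle _ Cy).
apply/ler_addgt0Pr => e e0.
have e20 : 0 < e / 2 by rewrite divr_gt0.
have := fcont p; move=> /cvgrPdist_lt /(_ _ e20) /Fp [d d0 sd].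
have md : 0 < Num.min d (e / 2) by rewrite lt_min d0.
have [x [Cx fx]] := S0 _ md.
have /sd /= : S d x by split=> //; apply: lt_le_trans fx _; rewrite lerD2l ge_min lexx.
have : f x < m + e / 2 by apply: lt_le_trans fx _; rewrite lerD2l ge_min lexx orbT.
rewrite ltr_norml => h1 /andP[h2 h3]; lra.
Qed.

Lemma sqr_dist_continuous x : continuous (fun y : H => `|x - y| ^+ 2).
Proof.
move=> y; apply: (@continuous_comp _ _ _ (fun y => `|x - y|) (fun t => t ^+ 2));
  last exact: exprn_continuous.
apply: (@continuous_comp _ _ _ (fun y => x - y) (fun t => `|t|)); last exact: norm_continuous.
by apply: continuousB; [exact: cvg_cst|exact: cvg_id].
Qed.

Lemma closed_convex_proj C x : closed C -> C !=set0 ->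
  (forall y z, C y -> C z -> C (2^-1 *: (y + z))) ->
  exists2 y, C y & forall z, C z -> `|x - y| <= `|x - z|.
Proof.
move=> Ccl C0 Cmid.
have [||||y Cy hy] := @uniformly_convex_min C (fun y => `|x - y| ^+ 2) 4^-1 Ccl C0.
- by rewrite invr_gt0.
- exact: sqr_dist_continuous.
- by move=> ? _; exact: sqr_ge0.
- by move=> y z Cy Cz; split; [exact: Cmid|rewrite sqr_norm_mid].
by exists y => // z /hy /=; rewrite ler_pXn2r ?nnegrE.
Qed.

(** Radial retraction: it brings x closer to every point of the ball at
    once. *)
Lemma ball_retract (M : R) x : 0 <= M -> exists2 y, `|y| <= M &
  forall z, `|z| <= M -> `|y - z| <= `|x - z|.
Proof.
move=> M0; case: (leP `|x| M) => [xM|Mx]; first by exists x.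
have x0 : 0 < `|x| := le_lt_trans M0 Mx.
pose s := M / `|x|.
have sx : s * `|x| = M by rewrite /s divfK ?gt_eqF.
have s0 : 0 <= s by rewrite divr_ge0 // ltW.
have s1 : s <= 1 by rewrite ler_pdivrMr // mul1r ltW.
exists (s *: x) => [|z zM]; first by rewrite normrZ ger0_norm// sx.
rewrite -(@ler_pXn2r _ 2)// ?nnegrE//.
rewrite !sqr_normB normrZ ger0_norm// sx dotZl.
have := cauchy_schwarz x z; rewrite ler_norml => /andP[_ h].
have h2 : dot x z <= `|x| * M by apply: le_trans h _; rewrite ler_pM2l.
(* |x - z|^2 - |s x - z|^2 = |x|^2 (1 - s)^2 + 2 (1 - s) (|x| M - dot x z) *)
have h3 : 0 <= (1 - s) * (`|x| * M - dot x z) by rewrite mulr_ge0 ?subr_ge0.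
rewrite -sx in h3 h2 *.
have h4 : 0 <= `|x| ^+ 2 * (1 - s) ^+ 2 by rewrite mulr_ge0 ?sqr_ge0.
nra.
Qed.
End hilbert.

(** * Integration over the ball *)

Section expectation.
Context {R : realType} {H : normedModType R}.
Implicit Types (f g : H -> R).

Lemma open_borel (A : set H) : open A -> measurable (A : set (borel H)).
Proof. by move=> oA; exact: sub_sigma_algebra. Qed.

Lemma closed_borel (A : set H) : closed A -> measurable (A : set (borel H)).
Proof.
move=> cA; rewrite -(setCK A); apply: measurableC; apply: open_borel.
exact: closed_openC.
Qed.

Lemma continuous_borel f : continuous f ->
  measurable_fun [set: borel H] (f : borel H -> R).
Proof.
move=> /continuousP cf; apply: (measurability _ (RGenOpens.measurableE R)).
move=> _ [_ [a [b ->] <-]]; rewrite setTI.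
by apply: open_borel; apply: cf; exact: interval_open.
Qed.

Context (M : R) (P : probability (borel H) R).

(** The closed ball is a set of [borel H], as integration requires;
    [closed_ball_] would make it a set of [H]. *)
Definition cball : set (borel H) := [set x : H | `|x| <= M].

Lemma cball_closed : closed (cball : set H).
Proof.
have -> : cball = closed_ball_ Num.norm 0 M.
  by apply/seteqP; split => x; rewrite /cball /closed_ball_ /= sub0r normrN.
exact: closed_closed_ball_.
Qed.

Lemma measurable_cball : measurable cball.
Proof. by apply: closed_borel; exact: cball_closed. Qed.

Definition prob (A : set H) : R := fine (P A).

Lemma probE (A : set (borel H)) : measurable A -> P A = (prob A)%:E.
Proof. by move=> mA; rewrite /prob fineK// fin_num_measure. Qed.

Lemma prob_ge0 A : 0 <= prob A.
Proof. exact/fine_ge0/measure_ge0. Qed.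

Lemma prob_le1 (A : set (borel H)) : measurable A -> prob A <= 1.
Proof. by move=> mA; rewrite -lee_fin -probE// probability_le1. Qed.

Lemma le_prob (A B : set (borel H)) : measurable A -> measurable B ->
  A `<=` B -> prob A <= prob B.
Proof. by move=> mA mB AB; rewrite -lee_fin -!probE// le_measure// inE. Qed.

Hypothesis PM : P cball = 1%E.

(** P charges only the ball, so measurability and boundedness on the ball
    suffice for integrability; the functions integrated below, such as squared
    distances, are unbounded on the whole space. *)
Definition tame f := measurable_fun [set: borel H] (f : borel H -> R) /\
  exists b, forall x, `|x| <= M -> `|f x| <= b.

Definition E f : R := \int[P]_(x in cball) f x.

Lemma tame_integrable f : tame f -> P.-integrable cball (EFin \o f).
Proof.
move=> [mf [b fb]]; apply: measurable_bounded_integrable.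
- exact: measurable_cball.
- exact: (le_lt_trans (probability_le1 P measurable_cball) (ltry _)).
- exact: measurable_funS mf.
- exists b; split; first exact: num_real.
  by move=> t bt x xM; apply: le_trans (fb _ xM) (ltW bt).
Qed.

Lemma tame_cst c : tame (cst c).
Proof. by split; [exact: measurable_cst | exists `|c|]. Qed.

Lemma tameD f g : tame f -> tame g -> tame (fun x => f x + g x).
Proof.
move=> [mf [b fb]] [mg [c gc]]; split; first exact: measurable_funD.
exists (b + c) => x xM; apply: le_trans (ler_normD _ _) _.
by rewrite lerD ?fb ?gc.
Qed.

Lemma tameM f g : tame f -> tame g -> tame (fun x => f x * g x).
Proof.
move=> [mf [b fb]] [mg [c gc]]; split; first exact: measurable_funM.
by exists (b * c) => x xM; rewrite normrM ler_pM ?fb ?gc.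
Qed.

Lemma tameZ a f : tame f -> tame (fun x => a * f x).
Proof. by move=> tf; apply: tameM => //; exact: tame_cst. Qed.

Lemma tameB f g : tame f -> tame g -> tame (fun x => f x - g x).
Proof.
move=> tf tg; apply: tameD => //.
by under eq_fun do rewrite -mulN1r; exact: tameZ.
Qed.

Lemma tame_sum (I : Type) (s : seq I) (p : pred I) (F : I -> H -> R) :
  (forall i, tame (F i)) -> tame (fun x => \sum_(i <- s | p i) F i x).
Proof.
move=> tF; elim: s => [|i s IH].
  by under eq_fun do rewrite big_nil; exact: tame_cst.
under eq_fun do rewrite big_cons.
by case: (p i) => //; exact: tameD.
Qed.

Lemma tame_indic (A : set (borel H)) : measurable A -> tame (\1_A : H -> R).
Proof.
move=> mA; split; first exact: measurable_indic.
exists 1 => x _; rewrite indicE; case: (_ \in _) => /=; rewrite ?normr1 ?normr0 //.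
Qed.

Lemma ED f g : tame f -> tame g -> E (fun x => f x + g x) = E f + E g.
Proof.
by move=> tf tg; apply: RintegralD; [exact: measurable_cball|
  exact: tame_integrable|exact: tame_integrable].
Qed.

Lemma EB f g : tame f -> tame g -> E (fun x => f x - g x) = E f - E g.
Proof.
by move=> tf tg; apply: RintegralB; [exact: measurable_cball|
  exact: tame_integrable|exact: tame_integrable].
Qed.

Lemma EZ a f : tame f -> E (fun x => a * f x) = a * E f.
Proof.
by move=> tf; apply: RintegralZl; [exact: measurable_cball|exact: tame_integrable].
Qed.

Lemma E_cst a : E (cst a) = a.
Proof.
transitivity (a * fine (P cball)); last by rewrite PM mulr1.
exact: (Rintegral_cst P measurable_cball a).
Qed.

Lemma eq_E f g : (forall x, `|x| <= M -> f x = g x) -> E f = E g.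
Proof. by move=> fg; apply: eq_Rintegral => x; rewrite inE => /fg. Qed.

Lemma E_sum (I : Type) (s : seq I) (p : pred I) (F : I -> H -> R) :
  (forall i, tame (F i)) ->
  E (fun x => \sum_(i <- s | p i) F i x) = \sum_(i <- s | p i) E (F i).
Proof.
move=> tF; elim: s => [|i s IH].
  rewrite big_nil -[RHS]E_cst; apply: eq_E => x _; by rewrite big_nil.
rewrite big_cons -IH; case: ifP => pi.
  rewrite -ED//; last exact: tame_sum.
  by apply: eq_E => x _; rewrite big_cons pi.
by apply: eq_E => x _; rewrite big_cons pi.
Qed.

Lemma le_E f g : tame f -> tame g -> (forall x, `|x| <= M -> f x <= g x) ->
  E f <= E g.
Proof.
by move=> tf tg fg; apply: le_Rintegral => //; [exact: measurable_cball|
  exact: tame_integrable|exact: tame_integrable].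
Qed.

Lemma E_ge0 f : (forall x, `|x| <= M -> 0 <= f x) -> 0 <= E f.
Proof. by move=> f0; apply: Rintegral_ge0. Qed.

Lemma prob_setC_cball : P (~` cball) = 0%E.
Proof. by rewrite probability_setC ?PM ?subee//; exact: measurable_cball. Qed.

Lemma prob_cballI (A : set (borel H)) : measurable A -> P (A `&` cball) = P A.
Proof.
move=> mA; have mb := measurable_cball.
have P0 := prob_setC_cball.
have P1 : P (A `\` cball) = 0%E.
  apply: (subset_measure0 _ _ _ P0); [exact: measurableD|exact: measurableC|].
  by move=> x [].
have -> : P A = (P (A `\` cball) + P (A `&` cball))%E by exact: measureDI.
by rewrite P1 add0e.
Qed.

Lemma E_indic (A : set (borel H)) : measurable A -> E \1_A = prob A.
Proof.
move=> mA; rewrite /E /Rintegral integral_indic//; last exact: measurable_cball.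
by congr fine; exact: prob_cballI.
Qed.

(** The complement of the ball is P-null, so P f is the integral over the
    ball. *)
Lemma integral_cball f : measurable_fun [set: borel H] (f : borel H -> R) ->
  (\int[P]_x (f x)%:E = \int[P]_(x in cball) (f x)%:E)%E.
Proof.
move=> mf; have mb := measurable_cball.
rewrite [RHS]integral_mkcond; apply: ae_eq_integral => //.
- exact/measurable_EFinP.
- apply/(measurable_restrictT _ _).1 => //; apply/measurable_EFinP.
  exact: measurable_funS mf.
exists (~` cball); split.
- exact: measurableC.
- exact: prob_setC_cball.
- move=> x /=; apply: contra_not => xb _; rewrite patchE.
  by case: ifPn => //; rewrite notin_setE.
Qed.

Lemma E_setT f : measurable_fun [set: borel H] (f : borel H -> R) ->
  \int[P]_x f x = E f.
Proof. by move=> mf; congr fine; exact: integral_cball. Qed.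

Lemma integral_tame f : tame f -> (\int[P]_x (f x)%:E = (E f)%:E)%E.
Proof.
move=> tf; rewrite integral_cball; last exact: tf.1.
apply/esym/fineK.
by apply: integrable_fin_num; [exact: measurable_cball|exact: tame_integrable].
Qed.

End expectation.

(** * The support of P *)

Section support.
Context {R : realType} {H : normedModType R}.

Lemma separable_seq : separable H ->
  exists u : nat -> H, forall x (e : R), 0 < e -> exists n, `|u n - x| < e.
Proof.
move=> [D [Dcount Ddense]].
have hit x (e : R) : 0 < e -> exists2 y, D y & `|y - x| < e.
  move=> e0; have [|y [xy Dy]] := Ddense _ _ (ball_open x e).
    by exists x; exact: ballxx.
  by exists y => //; move: xy; rewrite -ball_normE /ball_ /= distrC.
move: Dcount; rewrite /countable => /pfcard_geP[D0|[u]].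
  by have [y] := hit 0 1 ltr01; rewrite D0.
exists u => x e /(hit x)[y Dy yx].
have [n _ un] := @surj _ _ _ _ u y Dy.
by exists n; rewrite un.
Qed.

Context (P : probability (borel H) R).

(** A point outside C has a P-null neighbourhood, which contains one of
    countably many balls with centre in a dense sequence and radius an inverse
    integer; hence the complement of C is covered by countably many null
    balls. *)
Lemma support_full (C : set H) : separable H -> closed C ->
  measure_support P `<=` C -> P (~` C) = 0%E.
Proof.
move=> /separable_seq[u uP] Ccl sC.
pose rad m : R := m.+1%:R^-1.
pose F n m : set (borel H) :=
  if P (ball (u n) (rad m)) == 0%E then ball (u n) (rad m) else set0.
have bo n m : measurable (ball (u n) (rad m) : set (borel H)).
  by apply: open_borel; exact: ball_open.
have mC : measurable (~` C : set (borel H)).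
  by apply: open_borel; exact: closed_openC.
have FN n m : P.-negligible (F n m).
  rewrite /F; case: ifPn => [/eqP P0|_]; last exact: negligible_set0.
  by exists (ball (u n) (rad m)); split.
have NN : P.-negligible (\bigcup_n \bigcup_m F n m).
  by apply: negligible_bigcup => n; exact: negligible_bigcup.
apply/(negligibleP P mC); apply: negligibleS NN => x Cx.
have : ~ measure_support P x by move=> /sC.
move=> /existsNP[U] /not_implyP[oU] /not_implyP[Ux /negP].
rewrite -leNgt => PU.
have := oU; rewrite openE => /(_ _ Ux) /nbhs_ballP[e /= e0 eU].
have [m me] : exists m, rad m < e / 2.
  have := ltr_add_invr (y := 0 : R) (x := e / 2).
  rewrite divr_gt0// => /(_ isT)[m]; rewrite add0r => h; by exists m.
have rm0 : 0 < rad m by rewrite invr_gt0.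
have [n un] := uP x _ rm0.
exists n => //; exists m => //.
rewrite /F ifT; first by rewrite -ball_normE.
rewrite eq_le measure_ge0 andbT; apply: le_trans PU.
rewrite le_measure ?inE//; first exact: open_borel.
move=> y; rewrite -ball_normE /ball_ /= => uy; apply: eU.
rewrite -ball_normE /ball_ /= -(subrK (u n) x) -addrA.
apply: le_lt_trans (ler_normD _ _) _; rewrite distrC; lra.
Qed.

End support.

(** * Contrast and cells *)

Section contrast.
Context {R : realType} {H : normedModType R} {k : nat}.
Implicit Types (c : 'I_k -> H) (x : H).

Lemma contrast_le c x j : contrast c x <= `|x - c j| ^+ 2.
Proof.
apply: ge_inf; last by exists j.
by exists 0 => _ [i _ <-]; exact: sqr_ge0.
Qed.

Lemma contrastP c x : (0 < k)%N -> exists j, contrast c x = `|x - c j| ^+ 2.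
Proof.
move=> k0; pose F (j : 'I_k) := `|x - c j| ^+ 2.
case: (@arg_minP _ _ _ (Ordinal k0) predT F isT) => i _ imin.
exists i; apply/eqP; rewrite eq_le contrast_le /=.
apply: lb_le_inf; first by exists (F i), i.
by move=> _ [j _ <-]; exact: imin.
Qed.

Lemma contrast_ge0 c x : 0 <= contrast c x.
Proof.
have [k0|] := ltnP 0 k; first by have [j ->] := contrastP c x k0; exact: sqr_ge0.
rewrite leqn0 => /eqP k0.
have j0 (j : 'I_k) : False by move: (ltn_ord j); rewrite [X in (_ < X)%N]k0.
rewrite /contrast; have -> : [set `|x - c j| ^+ 2 | j in [set: 'I_k]] = set0.
  by apply/seteqP; split => // t [j _ _]; case: (j0 j).
by rewrite inf0.
Qed.

(** Ties between nearest centres go to the smallest index, so that the cells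
    of a codebook form an exact partition of H. *)
Definition cell c (i : 'I_k) : set (borel H) := [set x : H | forall j : 'I_k,
  if (j < i)%N then `|x - c i| < `|x - c j| else `|x - c i| <= `|x - c j|].

Lemma cell_le c i j x : cell c i x -> `|x - c i| <= `|x - c j|.
Proof. by move=> /(_ j); case: ifP => // _ /ltW. Qed.

Lemma cell_voronoi c i : cell c i `<=` voronoi c i.
Proof. by move=> x xi j _; exact: cell_le. Qed.

Lemma cell_inj c i j x : cell c i x -> cell c j x -> i = j.
Proof.
move=> ci cj; apply: val_inj; apply/eqP; rewrite eqn_leq.
case: (ltnP j i) => ji; first by have := ci j; rewrite ji ltNge (cell_le _ cj).
rewrite andTb leqNgt; apply/negP => ij.
by have := cj i; rewrite ij ltNge (cell_le _ ci).
Qed.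

Lemma cell_ex c x : (0 < k)%N -> exists i, cell c i x.
Proof.
move=> k0; pose F (j : 'I_k) := `|x - c j|.
case: (@arg_minP _ _ _ (Ordinal k0) predT F isT) => i0 _ i0min.
case: (@arg_minnP _ i0 (fun i => F i == F i0) (fun i : 'I_k => nat_of_ord i) (eqxx _)).
move=> i /eqP Fi imin; exists i => j; rewrite -/(F i) -/(F j) Fi.
case: ltnP => ji; last exact: i0min.
rewrite lt_neqAle i0min// andbT eq_sym; apply/negP => /imin.
by rewrite leqNgt ji.
Qed.

Lemma closer_closed (a b : H) : closed [set x : H | `|x - a| <= `|x - b|].
Proof.
have cn d : continuous (fun x : H => `|x - d|).
  move=> x; apply: (@continuous_comp _ _ _ (fun y => y - d) (fun t => `|t|));
    last exact: norm_continuous.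
  by apply: continuousB; [exact: cvg_id|exact: cvg_cst].
have -> : [set x | `|x - a| <= `|x - b|] =
   (fun x => `|x - b| - `|x - a|) @^-1` [set t | 0 <= t].
  by apply/seteqP; split => x /=; rewrite subr_ge0.
apply: closed_comp; last exact: closed_ge.
by move=> x _; apply: cvgB; exact: cn.
Qed.

Lemma voronoi_closed c i : closed (voronoi c i).
Proof.
have -> : voronoi c i = \bigcap_(j in [set j | j != i]) [set x | `|x - c i| <= `|x - c j|].
  by apply/seteqP; split => x h j; exact: h.
by apply: closed_bigI => j _; exact: closer_closed.
Qed.

Lemma measurable_cell c i : measurable (cell c i).
Proof.
have -> : cell c i = \bigcap_(j in [set: 'I_k]) [set x : H |
  if (j < i)%N then `|x - c i| < `|x - c j| else `|x - c i| <= `|x - c j|].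
  by apply/seteqP; split => x h j; [move=> _; exact: h|exact: h].
apply: fin_bigcap_measurable; first exact: finite_finset.
move=> j _; case: ltnP => _; last by apply: closed_borel; exact: closer_closed.
have -> : [set x : H | `|x - c i| < `|x - c j|] = ~` [set x | `|x - c j| <= `|x - c i|].
  by apply/seteqP; split => x /=; rewrite ltNge => /negP.
by apply: measurableC; apply: closed_borel; exact: closer_closed.
Qed.

Lemma cell_sum c i x (F : 'I_k -> R) : cell c i x ->
  \sum_j \1_(cell c j) x * F j = F i.
Proof.
move=> ci; rewrite (bigD1 i)//= indicE mem_set// mul1r big1 ?addr0// => j ji.
rewrite indicE memNset ?mul0r// => cj; move: ji.
by rewrite (cell_inj cj ci) eqxx.
Qed.

Lemma cell_contrast c i x : cell c i x -> contrast c x = `|x - c i| ^+ 2.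
Proof.
move=> ci; have k0 : (0 < k)%N by case: (i) => m /(leq_ltn_trans _); exact.
have [j h] := contrastP c x k0; apply/eqP; rewrite eq_le contrast_le h /=.
by rewrite ler_pXn2r ?nnegrE// cell_le.
Qed.

End contrast.

(** * Moments of inertia and centroids *)

Section inertia.
Context {R : realType} {H : completeNormedModType R} {dot : {dot H for idfun}}.
Hypothesis dot_norm : forall x : H, dot x x = `|x| ^+ 2.
Context (M : R) (P : probability (borel H) R).
Hypothesis M_gt0 : 0 < M.
Hypothesis PM : P (cball M) = 1%E.
Implicit Types (A : set (borel H)) (m h x : H).
Local Notation Ex := (E M P).

Lemma tame_sqd m : tame M (fun x : H => `|x - m| ^+ 2).
Proof.
split.
  apply: continuous_borel.
  by under eq_fun do rewrite distrC; exact: sqr_dist_continuous.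
exists ((M + `|m|) ^+ 2) => x xM; rewrite ger0_norm ?sqr_ge0//.
rewrite ler_pXn2r ?nnegrE// ?addr_ge0 ?(ltW M_gt0)//.
by apply: le_trans (ler_normB _ _) _; rewrite lerD2r.
Qed.

Lemma tame_dot m h : tame M (fun x : H => dot (x - m) h).
Proof.
have -> : (fun x : H => dot (x - m) h) = (fun x =>
    2^-1 * (`|x - m| ^+ 2 - `|x - (m + h)| ^+ 2 + `|h| ^+ 2)).
  by apply/funext => x; rewrite opprD addrA (sqr_normB dot_norm (x - m) h); field.
apply: tameZ; apply: tameD; last exact: tame_cst.
by apply: tameB; exact: tame_sqd.
Qed.

Lemma tame_ind A f : measurable A -> tame M f -> tame M (fun x : H => \1_A x * f x).
Proof. by move=> mA tf; apply: tameM => //; exact: tame_indic. Qed.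

Lemma indic_ge0 A x : 0 <= \1_A x :> R.
Proof. by rewrite indicE; case: (_ \in _). Qed.

Lemma indic_le1 A x : \1_A x <= 1 :> R.
Proof. by rewrite indicE; case: (_ \in _). Qed.

Definition inertia A m : R := Ex (fun x => \1_A x * `|x - m| ^+ 2).

(** The centroid is characterised weakly, by testing against every vector,
    which avoids integrating H-valued functions. *)
Definition centroid A m := forall h, Ex (fun x => \1_A x * dot (x - m) h) = 0.

Lemma inertia_ge0 A m : 0 <= inertia A m.
Proof.
apply: E_ge0 => x _; apply: mulr_ge0; last exact: sqr_ge0.
by rewrite indicE; case: (_ \in _).
Qed.

(** Moving the reference point by - s h makes the inertia a quadratic
    polynomial in s: its linear coefficient is the centroid condition, its
    quadratic one the mass. *)
Lemma inertia_shift A m h (s : R) : measurable A ->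
  inertia A (m - s *: h) = inertia A m +
    2 * s * Ex (fun x => \1_A x * dot (x - m) h) + s ^+ 2 * (`|h| ^+ 2 * prob P A).
Proof.
move=> mA; rewrite -(E_indic PM mA) /inertia.
have t1 := tame_ind mA (tame_sqd m); have t2 := tame_ind mA (tame_dot m h).
have t3 : tame M (\1_A : H -> R) := tame_indic M mA.
rewrite [X in _ = _ + _ + X]mulrA -(EZ P _ t2) -(EZ P _ t3).
have t4 := tameZ (2 * s) t2; have t5 := tameZ (s ^+ 2 * `|h| ^+ 2) t3.
rewrite -(ED P t1 t4) -(ED P (tameD t1 t4) t5).
apply: eq_E => x _.
have -> : x - (m - s *: h) = (x - m) - (- s) *: h.
  by rewrite opprB addrA addrAC scaleNr opprK.
rewrite (sqr_normB dot_norm (x - m)) normrZ normrN exprMn real_normK ?num_real//.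
by rewrite dotZr; ring.
Qed.

Lemma centroid_inertia A m c : measurable A -> centroid A m ->
  inertia A c = inertia A m + prob P A * `|c - m| ^+ 2.
Proof.
move=> mA /(_ (m - c)) cm; have := @inertia_shift A m (m - c) 1 mA.
rewrite scale1r subKr cm mulr0 addr0 expr1n mul1r => ->.
by rewrite mulrC distrC.
Qed.

(** Testing the centroid m against itself gives
    mass * |m|^2 <= mass * M * |m|. *)
Lemma centroid_ball A m : measurable A -> 0 < prob P A -> centroid A m -> `|m| <= M.
Proof.
move=> mA A0 cm; rewrite leNgt; apply/negP => Mm.
have m0 : 0 < `|m| := lt_trans M_gt0 Mm.
have : Ex (fun x => \1_A x * dot (x - m) m) <= Ex (fun x => (M * `|m| - `|m| ^+ 2) * \1_A x).
  apply: le_E => //.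
  - by apply: tame_ind => //; exact: tame_dot.
  - by apply: tameZ; exact: tame_indic.
  move=> x xM; rewrite mulrC ler_wpM2r ?indic_ge0//.
  rewrite dotBl dot_norm lerD2r; apply: le_trans (ler_norm _) _.
  by apply: le_trans (cauchy_schwarz dot_norm _ _) _; rewrite ler_wpM2r.
rewrite cm EZ ?E_indic//; last exact: tame_indic.
have neg : M * `|m| - `|m| ^+ 2 < 0 by rewrite expr2 -mulrBl pmulr_llt0// subr_lt0.
by rewrite leNgt nmulr_rlt0 ?A0.
Qed.

(** Were the linear coefficient b of [inertia_shift] nonzero, a small step
    - t b in the direction h would lower the inertia. *)
Lemma local_min_centroid A m d : measurable A -> 0 < d ->
  (forall c, `|c - m| < d -> inertia A m <= inertia A c) -> centroid A m.
Proof.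
move=> mA d0 mmin h; set b := Ex _; apply/eqP; apply/negPn/negP => b0.
pose q := `|h| ^+ 2 * prob P A.
have q0 : 0 <= q by rewrite mulr_ge0 ?sqr_ge0 ?prob_ge0.
(* t q < 2 makes the linear term win, the second bound keeps the step below d *)
pose t := Num.min (q + 1)^-1 (d / 2 / (`|b| * `|h| + 1)).
have bh0 : 0 <= `|b| * `|h| by rewrite mulr_ge0.
have t0 : 0 < t.
  by rewrite lt_min invr_gt0 !divr_gt0// ?ltr_wpDl.
have t1 : t * (q + 1) <= 1.
  by rewrite -ler_pdivlMr ?ltr_wpDl// div1r ge_min lexx.
have t2 : t * (`|b| * `|h| + 1) <= d / 2.
  by rewrite -ler_pdivlMr ?ltr_wpDl// ge_min lexx orbT.
have := mmin (m - (- t * b) *: h).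
rewrite [in X in X -> _]addrC addKr normrN normrZ normrM normrN (gtr0_norm t0) -mulrA.
have -> : t * (`|b| * `|h|) < d by nra.
move=> /(_ isT); rewrite inertia_shift// -/b -/q.
have b20 : 0 < b ^+ 2 by rewrite exprn_even_gt0.
have : 0 < t * b ^+ 2 by rewrite mulr_gt0.
have : t * q < 2 by nra.
nra.
Qed.

Lemma inertia_mid A m c : measurable A ->
  inertia A (2^-1 *: (m + c)) =
  (inertia A m + inertia A c) / 2 - prob P A / 4 * `|m - c| ^+ 2.
Proof.
move=> mA; rewrite -(E_indic PM mA) /inertia.
have t1 := tame_ind mA (tame_sqd m); have t2 := tame_ind mA (tame_sqd c).
have t3 : tame M (\1_A : H -> R) := tame_indic M mA.
transitivity (2^-1 * (Ex (fun x : H => \1_A x * `|x - m| ^+ 2) +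
    Ex (fun x : H => \1_A x * `|x - c| ^+ 2)) - (4^-1 * `|m - c| ^+ 2) * Ex \1_A); last by field.
rewrite -(ED P)// -!(EZ P)//; last exact: tameD.
rewrite -(EB P)//; [|by apply: tameZ; exact: tameD|exact: tameZ].
by apply: eq_E => x _; rewrite (sqr_norm_mid dot_norm); field.
Qed.

Lemma inertia_continuous A : measurable A -> continuous (inertia A : H -> R).
Proof.
move=> mA m.
have bd c : `|c - m| < 1 -> `|inertia A m - inertia A c| <= (2 * M + 2 * `|m| + 1) * `|m - c|.
  move=> cm1; rewrite /inertia -EB//; try (by apply: tame_ind => //; exact: tame_sqd).
  have tb : tame M (fun x : H => \1_A x * `|x - m| ^+ 2 - \1_A x * `|x - c| ^+ 2).
    by apply: tameB; apply: tame_ind => //; exact: tame_sqd.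
  set K := (X in _ <= X).
  have pw x : `|x| <= M -> `|\1_A x * `|x - m| ^+ 2 - \1_A x * `|x - c| ^+ 2| <= K.
    move=> xM; rewrite -mulrBr normrM (ger0_norm (indic_ge0 _ _)).
    apply: le_trans (_ : 1 * `| `|x - m| ^+ 2 - `|x - c| ^+ 2| <= _).
      by rewrite ler_wpM2r ?indic_le1.
    rewrite mul1r subr_sqr normrM /K mulrC.
    have h1 : `| `|x - m| - `|x - c| | <= `|m - c|.
      by apply: le_trans (ler_dist_dist _ _) _; rewrite opprB addrC addrA subrK distrC.
    rewrite ler_pM// ger0_norm ?addr_ge0//.
    have h2 := ler_normB x m. have h3 := ler_normB x c.
    have : `|c| <= `|c - m| + `|m| by rewrite -{1}(subrK m c) ler_normD.
    lra.
  rewrite ler_norml -[X in X <= _](E_cst PM) -[X in _ && (_ <= X)](E_cst PM).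
  by apply/andP; split; apply: le_E => //; try exact: tame_cst;
    move=> x /pw; rewrite ler_norml => /andP[].
apply/cvgrPdist_lt => e e0.
have K0 : 0 < 2 * M + 2 * `|m| + 1 by have m0 : 0 <= `|m| := normr_ge0 m; have := M_gt0; lra.
near=> c.
have h1 : `|m - c| < 1.
  by near: c; apply: cvgr_dist_lt => //; exact: cvg_id.
have h2 : `|m - c| < e / (2 * M + 2 * `|m| + 1).
  by near: c; apply: cvgr_dist_lt; rewrite ?divr_gt0//; exact: cvg_id.
apply: le_lt_trans (bd c _) _; first by rewrite distrC.
by rewrite mulrC -ltr_pdivlMr.
Unshelve. all: by end_near. Qed.

Lemma centroid_exists A : measurable A -> 0 < prob P A -> exists m, centroid A m.
Proof.
move=> mA A0.
have [||||||m _ mmin] := @uniformly_convex_min R H setT (inertia A) (prob P A / 4).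
- exact: closedT.
- by exists 0.
- by rewrite divr_gt0.
- exact: inertia_continuous.
- by move=> ? _; exact: inertia_ge0.
- by move=> x y _ _; split => //; rewrite inertia_mid.
exists m; apply: (@local_min_centroid A m 1) => // c _.
exact: mmin.
Qed.

End inertia.

(** * The codebook norm *)

Section codebook_norm.
Context {R : realType} {H : normedModType R} {k : nat}.
Implicit Types (c u v : 'I_k -> H).

Lemma sumsq_ge0 c : 0 <= \sum_(i < k) `|c i| ^+ 2.
Proof. by apply: sumr_ge0 => i _; exact: sqr_ge0. Qed.

Lemma codebook_norm_ge0 c : 0 <= codebook_norm c.
Proof. exact: sqrtr_ge0. Qed.

Lemma sqr_codebook_norm c : codebook_norm c ^+ 2 = \sum_(i < k) `|c i| ^+ 2.
Proof. by rewrite sqr_sqrtr// sumsq_ge0. Qed.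

Lemma le_codebook_norm c i : `|c i| <= codebook_norm c.
Proof.
rewrite -(@ler_pXn2r _ 2) ?nnegrE ?codebook_norm_ge0// sqr_codebook_norm.
by rewrite (bigD1 i)//= lerDl; apply: sumr_ge0 => j _; exact: sqr_ge0.
Qed.

Lemma le_codebook_norm2 c i j : i != j ->
  `|c i| + `|c j| <= Num.sqrt 2 * codebook_norm c.
Proof.
move=> ij; have s20 : 0 <= Num.sqrt 2 * codebook_norm c.
  by rewrite mulr_ge0 ?sqrtr_ge0.
rewrite -(@ler_pXn2r _ 2) ?nnegrE ?addr_ge0//.
rewrite exprMn sqr_sqrtr// sqr_codebook_norm (bigD1 i)//= (bigD1 j)/=; last by rewrite eq_sym.
set s := \sum_(_ < _ | _) _.
have s0 : 0 <= s by apply: sumr_ge0 => l _; exact: sqr_ge0.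
have := sqr_ge0 (`|c i| - `|c j|); nra.
Qed.

Lemma codebook_norm0_eq u v : codebook_norm (u - v) = 0 -> u = v.
Proof.
move=> h; apply/funext => i; apply/eqP; rewrite -subr_eq0 -normr_le0.
by have := le_codebook_norm (u - v) i; rewrite h.
Qed.

Lemma codebook_normB u v : codebook_norm (u - v) = codebook_norm (v - u).
Proof. by congr Num.sqrt; apply: eq_bigr => i _; rewrite /= distrC. Qed.

Lemma codebook_norm_scale (s : R) u : codebook_norm (fun i => s *: u i) = `|s| * codebook_norm u.
Proof.
rewrite /codebook_norm -[X in X * _]sqrtr_sqr -sqrtrM ?sqr_ge0//; congr Num.sqrt.
rewrite mulr_sumr; apply: eq_bigr => i _.
by rewrite normrZ exprMn real_normK ?num_real.
Qed.

Lemma sum_cauchy_schwarz (a b : 'I_k -> R) : (forall i, 0 <= a i) -> (forall i, 0 <= b i) ->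
  \sum_i a i * b i <= Num.sqrt (\sum_i a i ^+ 2) * Num.sqrt (\sum_i b i ^+ 2).
Proof.
move=> a0 b0; set A := \sum_i a i ^+ 2; set B := \sum_i b i ^+ 2.
have A0 : 0 <= A by apply: sumr_ge0 => i _; exact: sqr_ge0.
have B0 : 0 <= B by apply: sumr_ge0 => i _; exact: sqr_ge0.
have zero (f g : 'I_k -> R) : \sum_i f i ^+ 2 = 0 -> \sum_i f i * g i = 0.
  move=> f0; apply: big1 => i _.
  have := psumr_eq0P (fun i _ => sqr_ge0 (f i)) f0 (erefl true) (i := i).
  by move=> /eqP; rewrite sqrf_eq0 => /eqP ->; rewrite mul0r.
have [A00|An0] := eqVneq A 0.
  by rewrite zero//; rewrite mulr_ge0 ?sqrtr_ge0.
have [B00|Bn0] := eqVneq B 0.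
  by under eq_bigr do rewrite mulrC; rewrite zero// mulr_ge0 ?sqrtr_ge0.
set p := Num.sqrt A; set q := Num.sqrt B.
have p0 : 0 < p by rewrite sqrtr_gt0 lt_def An0.
have q0 : 0 < q by rewrite sqrtr_gt0 lt_def Bn0.
have pA : p ^+ 2 = A by rewrite sqr_sqrtr.
have qB : q ^+ 2 = B by rewrite sqr_sqrtr.
have pq0 : 0 < 2 * p * q by rewrite !mulr_gt0.
rewrite -(ler_pM2l pq0) mulr_sumr.
apply: (@le_trans _ _ (\sum_i (q ^+ 2 * a i ^+ 2 + p ^+ 2 * b i ^+ 2))).
  by apply: ler_sum => i _; have := sqr_ge0 (q * a i - p * b i); nra.
rewrite big_split/= -!mulr_sumr -/A -/B -pA -qB; nra.
Qed.

Lemma ler_codebook_normD u v : codebook_norm (u + v) <= codebook_norm u + codebook_norm v.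
Proof.
rewrite -(@ler_pXn2r _ 2) ?nnegrE ?addr_ge0 ?codebook_norm_ge0//.
rewrite sqrrD -mulr_natl !sqr_codebook_norm.
apply: (@le_trans _ _ (\sum_i (`|u i| ^+ 2 + 2 * (`|u i| * `|v i|) + `|v i| ^+ 2))).
  apply: ler_sum => i _; rewrite mulr_natl -sqrrD ler_pXn2r ?nnegrE ?addr_ge0//.
  exact: ler_normD.
rewrite !big_split/= lerD2r lerD2l -mulr_sumr ler_pM2l//.
exact: sum_cauchy_schwarz.
Qed.

Lemma ler_dist_codebook_norm u v w :
  codebook_norm (u - w) <= codebook_norm (u - v) + codebook_norm (v - w).
Proof.
by apply: le_trans (ler_codebook_normD _ _); rewrite addrA subrK.
Qed.

End codebook_norm.

(** * Risk and Lloyd's step *)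

Section quantization.
Context {R : realType} {H : completeNormedModType R} {dot : {dot H for idfun}}.
Hypothesis dot_norm : forall x : H, dot x x = `|x| ^+ 2.
Context (M : R) (P : probability (borel H) R).
Hypothesis M_gt0 : 0 < M.
Hypothesis PM : P (cball M) = 1%E.
Local Notation Ex := (E M P).
Local Notation inertia := (inertia M P).
Local Notation centroid := (@centroid _ _ dot M P).

Lemma in_ballE k (c : 'I_k -> H) : in_ball M c <-> forall i, `|c i| <= M.
Proof. by split=> h i; have := h i; rewrite /closed_ball_ /= sub0r normrN. Qed.

Lemma sqd_lip (x a b : H) : `|x| <= M -> `|a| <= M -> `|b| <= M ->
  `|x - a| ^+ 2 - `|x - b| ^+ 2 <= 4 * M * `|a - b|.
Proof.
move=> xM aM bM; rewrite subr_sqr.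
have h1 : `|x - a| <= `|x - b| + `|a - b|.
  by rewrite (distrC a b); apply: le_trans (ler_normD _ _); rewrite addrA subrK.
have := ler_normB x a; have := ler_normB x b.
have := normr_ge0 (x - a); have := normr_ge0 (x - b); have := normr_ge0 (a - b).
move: (`|x - a|) (`|x - b|) (`|a - b|) h1 => p q r h1 h2 h3 h4 h5 h6.
have : p + q <= 4 * M by lra.
nra.
Qed.

Section fixed_size.
Context {k : nat}.
Hypothesis k_gt0 : (0 < k)%N.
Implicit Types c : 'I_k -> H.

Lemma contrastE c x : contrast c x = \sum_i \1_(cell c i) x * `|x - c i| ^+ 2.
Proof.
have [i ci] := cell_ex c x k_gt0.
by rewrite (cell_contrast ci) (cell_sum (fun i => `|x - c i| ^+ 2) ci).
Qed.

Lemma tame_contrast c : tame M (contrast c).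
Proof.
rewrite (funext (contrastE c)); apply: tame_sum => i.
by apply: tame_ind; [exact: measurable_cell|exact: tame_sqd].
Qed.

Lemma risk_E c : risk P c = Ex (contrast c).
Proof. by rewrite /risk (E_setT PM)//; case: (tame_contrast c). Qed.

(** The quantization error when the points are assigned by the cells of the
    first codebook but represented by the centres of the second. *)
Definition cost c c' : R := \sum_i inertia (cell c i) (c' i).

Lemma cost_E c c' : cost c c' = Ex (fun x => \sum_i \1_(cell c i) x * `|x - c' i| ^+ 2).
Proof.
rewrite E_sum// => i.
by apply: tame_ind; [exact: measurable_cell|exact: tame_sqd].
Qed.

Lemma tame_cost c c' : tame M (fun x => \sum_i \1_(cell c i) x * `|x - c' i| ^+ 2).
Proof.
apply: tame_sum => i.
by apply: tame_ind; [exact: measurable_cell|exact: tame_sqd].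
Qed.

Lemma risk_cost c : risk P c = cost c c.
Proof. by rewrite risk_E cost_E; apply: eq_E => x _; exact: contrastE. Qed.

Lemma risk_le_cost c c' : risk P c' <= cost c c'.
Proof.
rewrite risk_E cost_E; apply: le_E; [exact: tame_contrast|exact: tame_cost|].
move=> x _; have [i ci] := cell_ex c x k_gt0.
by rewrite (cell_sum (fun i => `|x - c' i| ^+ 2) ci) contrast_le.
Qed.

Lemma contrast_lip c c' x : in_ball M c -> in_ball M c' -> `|x| <= M ->
  contrast c x - contrast c' x <= 4 * M * codebook_norm (c - c').
Proof.
move=> /in_ballE cM /in_ballE c'M xM; have [i ->] := contrastP c' x k_gt0.
have := contrast_le c x i; have := sqd_lip xM (cM i) (c'M i).
have := le_codebook_norm (c - c') i => /= h1 h2 h3.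
have : 4 * M * `|c i - c' i| <= 4 * M * codebook_norm (c - c').
  by rewrite ler_pM2l// mulr_gt0.
lra.
Qed.

Lemma risk_lip c c' : in_ball M c -> in_ball M c' ->
  risk P c <= risk P c' + 4 * M * codebook_norm (c - c').
Proof.
move=> cM c'M; rewrite !risk_E -(E_cst PM (4 * M * _)).
rewrite -ED; [|exact: tame_contrast|exact: tame_cst].
apply: le_E; [exact: tame_contrast|apply: tameD; [exact: tame_contrast|exact: tame_cst]|].
by move=> x xM; have := contrast_lip cM c'M xM => /=; lra.
Qed.

(** Points of the support are in the ball, so retracting the centres to the
    ball brings them closer to the support. This reduces every minimisation to
    codebooks in the ball. *)
Lemma ball_retract_codebook c : exists c', [/\ in_ball M c', risk P c' <= risk P c
  & forall i z, `|z| <= M -> `|c' i - z| <= `|c i - z|].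
Proof.
have /choice[c' c'P] i : exists y, `|y| <= M /\
    forall z, `|z| <= M -> `|y - z| <= `|c i - z|.
  by have [y] := ball_retract dot_norm (c i) (ltW M_gt0); exists y.
exists c'; split.
- by apply/in_ballE => i; exact: (c'P i).1.
- rewrite !risk_E; apply: le_E; [exact: tame_contrast|exact: tame_contrast|].
  move=> x xM; have [i ->] := contrastP c x k_gt0.
  apply: le_trans (contrast_le c' x i) _; rewrite ler_pXn2r ?nnegrE//.
  by rewrite !(distrC x); exact: (c'P i).2.
- by move=> i; exact: (c'P i).2.
Qed.

Definition replace c (i : 'I_k) (v : H) : 'I_k -> H := fun j => if j == i then v else c j.

Lemma codebook_norm_replace c i v : codebook_norm (replace c i v - c) = `|v - c i|.
Proof.
have rE j : (replace c i v - c) j = if j == i then v - c i else 0.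
  change ((if j == i then v else c j) - c j = if j == i then v - c i else 0).
  by case: eqP => [->|_]//; rewrite subrr.
rewrite /codebook_norm (bigD1 i)//= big1 => [|j ji].
  by rewrite addr0 rE eqxx sqrtr_sqr normr_id.
by rewrite rE (negbTE ji) normr0 expr0n.
Qed.

(** Freeze the cells of c and move its i-th centre alone: the risk is at
    most the frozen cost, with equality at c, so c i locally minimizes the
    inertia of its cell. *)
Lemma local_minimizer_centroid c : local_minimizer P c ->
  forall i, centroid (cell c i) (c i).
Proof.
move=> [d d0 cmin] i.
apply: (@local_min_centroid _ _ _ dot_norm M P M_gt0 PM _ _ d) => //; first exact: measurable_cell.
move=> v vd; have := cmin (replace c i v); rewrite codebook_norm_replace => /(_ vd) h.
have := le_trans h (risk_le_cost c (replace c i v)).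
rewrite risk_cost /cost (bigD1 i)//= [X in _ <= X](bigD1 i)//= {1}/replace eqxx.
rewrite [X in _ <= _ + X](eq_bigr (fun j => inertia (cell c j) (c j))) ?lerD2r// => j ji.
by rewrite /replace (negbTE ji).
Qed.

Lemma optimal_local_minimizer c : optimal k P c -> local_minimizer P c.
Proof. by move=> copt; exists 1. Qed.

Lemma lloyd_exists c : (forall i, 0 < prob P (cell c i)) ->
  exists m : 'I_k -> H, forall i, centroid (cell c i) (m i).
Proof.
move=> cpos; have /choice[m mP] i : exists v, centroid (cell c i) v.
  by apply: centroid_exists => //; exact: measurable_cell.
by exists m.
Qed.

(** With the cells frozen the cost is a sum of parabolas centred at the
    centroids, so it decreases along the segment from c to them. Lloyd's step
    is used through this whole path, not only through its endpoint. *)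
Lemma lloyd_path c m (s : R) : 0 <= s <= 1 -> (forall i, centroid (cell c i) (m i)) ->
  risk P (fun i => c i + s *: (m i - c i)) <= risk P c.
Proof.
move=> /andP[s0 s1] cm; apply: le_trans (risk_le_cost c _) _.
rewrite risk_cost; apply: ler_sum => i _.
have mc := measurable_cell c i.
rewrite (centroid_inertia dot_norm M_gt0 PM (c i + _) mc (cm i)).
rewrite (centroid_inertia dot_norm M_gt0 PM (c i) mc (cm i)) lerD2l.
rewrite ler_wpM2l ?prob_ge0//.
have -> : c i + s *: (m i - c i) - m i = (1 - s) *: (c i - m i).
  by rewrite scalerBl scale1r -[X in _ - X]opprK -scalerN opprB opprK addrAC.
rewrite normrZ exprMn real_normK ?num_real// ler_piMl ?sqr_ge0//.
by rewrite -[X in _ <= X](expr1n _ 2) ler_pXn2r ?nnegrE//; lra.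
Qed.

Lemma lloyd_risk c m : (forall i, centroid (cell c i) (m i)) -> risk P m <= risk P c.
Proof.
move=> cm; have := lloyd_path (s := 1) _ cm; rewrite ler01 lexx => /(_ isT).
congr (_ <= _); congr risk; apply/funext => i; by rewrite scale1r addrC subrK.
Qed.

End fixed_size.

End quantization.

(** * Deleting a centre *)

Section drop_center.
Context {R : realType} {H : completeNormedModType R}.
Context (M : R) (P : probability (borel H) R).
Hypothesis M_gt0 : 0 < M.
Hypothesis PM : P (cball M) = 1%E.
Context {n : nat}.
Hypothesis n_gt0 : (0 < n)%N.
Implicit Types c : 'I_n.+1 -> H.

Definition drop_center c (i : 'I_n.+1) : 'I_n -> H := fun j => c (lift i j).

Lemma contrast_drop_ge c i x : contrast c x <= contrast (drop_center c i) x.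
Proof. by have [j ->] := contrastP (drop_center c i) x n_gt0; exact: contrast_le. Qed.

Lemma contrast_drop_eq c i x : ~ cell c i x -> contrast (drop_center c i) x = contrast c x.
Proof.
move=> ncx; apply/eqP; rewrite eq_le contrast_drop_ge andbT.
have [j cj] := cell_ex c x (ltn0Sn n).
have ij : i != j by apply/eqP => ij; apply: ncx; rewrite ij.
have [l jl _] := unlift_some ij.
by rewrite (cell_contrast cj) jl; exact: contrast_le.
Qed.

(** Deleting a centre changes the contrast only on the cell of that
    centre. Since the risk with one centre less is bounded below by rho, a
    codebook of risk below rho must have heavy cells ([cell_mass_gt0],
    [cell_mass_lb]) and well separated centres ([centers_sep_lb]). *)
Lemma risk_drop c i t :
  (forall x, `|x| <= M -> cell c i x -> contrast (drop_center c i) x <= contrast c x + t) ->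
  risk P (drop_center c i) <= risk P c + t * prob P (cell c i).
Proof.
move=> ct; rewrite (risk_E M_gt0 PM n_gt0) (risk_E M_gt0 PM (ltn0Sn n)).
have mc := measurable_cell c i; have t1 := tame_indic M mc.
rewrite -(E_indic PM mc) -(EZ P _ t1).
have t2 := tame_contrast M_gt0 (ltn0Sn n) c.
rewrite -(ED P t2 (tameZ t t1)).
apply: le_E; [exact: tame_contrast|exact: tameD t2 (tameZ t t1)|].
move=> x xM; have [xc|xc] := pselect (cell c i x).
  by rewrite indicE mem_set// mulr1 ct.
by rewrite contrast_drop_eq// indicE memNset// mulr0 addr0.
Qed.

Context {rho : R}.
Hypothesis rhoP : forall b : 'I_n -> H, rho <= risk P b.

Lemma cell_mass_gt0 c i : risk P c < rho -> 0 < prob P (cell c i).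
Proof.
move=> cr; rewrite lt_def prob_ge0 andbT; apply/eqP => p0.
pose j := Ordinal n_gt0.
have := rhoP (drop_center c i); rewrite leNgt => /negP; apply.
apply: le_lt_trans (_ : risk P c + (M + `|drop_center c i j|) ^+ 2 * prob P (cell c i) < _).
  apply: risk_drop => x xM _.
  apply: le_trans (contrast_le _ x j) _; apply: ler_wpDl; first exact: contrast_ge0.
  rewrite ler_pXn2r ?nnegrE ?addr_ge0 ?(ltW M_gt0)//.
  by apply: le_trans (ler_normB _ _) _; rewrite lerD2r.
by rewrite p0 mulr0 addr0.
Qed.

Lemma cell_mass_lb c i : in_ball M c -> rho <= risk P c + 4 * M ^+ 2 * prob P (cell c i).
Proof.
move=> /in_ballE cM; apply: le_trans (rhoP (drop_center c i)) _; apply: risk_drop => x xM _.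
pose j := Ordinal n_gt0.
apply: le_trans (contrast_le _ x j) _; apply: ler_wpDl; first exact: contrast_ge0.
have -> : 4 * M ^+ 2 = (2 * M) ^+ 2 by ring.
rewrite ler_pXn2r ?nnegrE ?mulr_ge0 ?(ltW M_gt0)//.
apply: le_trans (ler_normB _ _) _; have := cM (lift i j).
by rewrite /drop_center; lra.
Qed.

Lemma centers_sep_lb c i j : in_ball M c -> i != j ->
  rho <= risk P c + 4 * M * `|c i - c j|.
Proof.
move=> /in_ballE cM ij; apply: le_trans (rhoP (drop_center c i)) _.
apply: le_trans (_ : risk P c + 4 * M * `|c i - c j| * prob P (cell c i) <= _).
  apply: risk_drop => x xM xi; rewrite (cell_contrast xi).
  have [l jl _] := unlift_some ij.
  apply: le_trans (contrast_le _ x l) _; rewrite /drop_center -jl.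
  by have := sqd_lip xM (cM j) (cM i); rewrite (distrC (c j)); lra.
rewrite lerD2l ler_piMr//; last by apply: prob_le1; exact: measurable_cell.
by rewrite mulr_ge0 ?mulr_ge0 ?(ltW M_gt0).
Qed.

End drop_center.

(** * Precompactness of heavy centroids *)

Section ultra.
Lemma ultra_fmap (T U : Type) (f : T -> U) (F : set_system T) :
  UltraFilter F -> UltraFilter (f @ F).
Proof.
move=> UF; split; first exact: fmap_proper_filter.
move=> G PG sFG; apply/seteqP; split => // A GA.
have [//|FnA] := in_ultra_setVsetC (f @^-1` A) UF.
have /filter_ex[x []] // : G (A `&` ~` A).
by apply: filterI => //; apply: sFG.
Qed.
End ultra.

Section compactness.
Context {R : realType} {H : completeNormedModType R} {dot : {dot H for idfun}}.
Hypothesis dot_norm : forall x : H, dot x x = `|x| ^+ 2.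
Context (M : R) (P : probability (borel H) R).
Hypothesis M_gt0 : 0 < M.
Hypothesis PM : P (cball M) = 1%E.
Hypothesis H_sep : separable H.
Local Notation Ex := (E M P).
Local Notation centroid := (@centroid _ _ dot M P).

(** Although balls of H are not compact, the lower bound on the mass makes
    this set totally bounded; all the compactness of the proof comes from it. *)
Definition heavy_centroids (d : R) : set H := [set m | exists A : set (borel H),
  [/\ measurable A, d <= prob P A & centroid A m]].

Lemma small_partition (e : R) : 0 < e -> exists (u : nat -> H) (Q : nat -> set (borel H)) (N : nat),
  [/\ forall l, measurable (Q l), forall l x, Q l x -> `|x - u l| <= e,
      forall x l l', Q l x -> Q l' x -> l = l'
    & 1 - e <= \sum_(l < N) prob P (Q l)].
Proof.
move=> e0; have [u uP] := separable_seq H_sep.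
pose B l : set (borel H) := ball (u l) e.
have mB l : measurable (B l) by apply: open_borel; exact: ball_open.
exists u, (seqDU B).
have mQ l : measurable (seqDU B l) by exact: seqDU_measurable.
have cov : \bigcup_l seqDU B l = setT.
  rewrite -seqDU_bigcup_eq; apply/seteqP; split => // x _.
  by have [l ul] := uP x e e0; exists l => //; rewrite /B -ball_normE.
have /cvg_ballP : (fun n => \sum_(0 <= l < n) prob P (seqDU B l)) @ \oo --> (1 : R).
  have := @measure_semi_sigma_additive _ _ _ P _ mQ (@trivIset_seqDU _ B).
  rewrite cov => /(_ measurableT) h.
  have h1 : (fun n => \sum_(0 <= l < n) P (seqDU B l))%E @ \oo --> 1%:E.
    by rewrite -(probability_setT P); exact: h.
  have /fine_cvg := h1; apply: cvg_trans; apply: near_eq_cvg; near=> n => /=.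
  rewrite -sum_fine// => l _; exact: fin_num_measure.
move=> /(_ _ e0) [N _ NP]; exists N; split => //.
- by move=> l x [+ _]; rewrite /B -ball_normE /ball_ /= distrC => /ltW.
- move=> x l l' Ql Ql'; apply: (@trivIset_seqDU _ B) => //; exists x; split; assumption.
have := NP N (leqnn N); rewrite -ball_normE /ball_ /= big_mkord ltr_norml => /andP[_].
lra.
Unshelve. all: by end_near. Qed.

(** Cut most of the mass into N small pieces Q l around points u l. The
    centroid of A is then close to the barycentre of the u l with weights
    P(A and Q l) / P(A): inside the pieces x is close to u l, and the rest of
    the mass is small compared with d. So heavy centroids lie near a polytope
    that depends only on the precision. *)
Lemma heavy_centroids_approx (d e : R) : 0 < d -> 0 < e ->
  exists (u : nat -> H) (N : nat), forall m, heavy_centroids d m ->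
    exists w : nat -> R, (forall l, 0 <= w l <= 1) /\
      `|m - \sum_(l < N) w l *: u l| <= e.
Proof.
(* two error terms: e' for points inside the pieces, M e' / d for the mass
   outside *)
move=> d0 e0; pose e' := Num.min (e / 2) (e * d / (2 * M)).
have e'0 : 0 < e' by rewrite lt_min !divr_gt0// !mulr_gt0.
have [u [Q [N [mQ Qu Qdisj QN]]]] := small_partition e'0.
exists u, N => m [A [mA dA cA]].
have A0 : 0 < prob P A := lt_le_trans d0 dA.
pose w l := prob P (A `&` Q l) / prob P A.
have mAQ l : measurable (A `&` Q l) by exact: measurableI.
exists w; split.
  move=> l; rewrite divr_ge0 ?prob_ge0//= ler_pdivrMr// mul1r.
  by apply: le_prob => //; exact: subIsetl.
set z := \sum_(l < N) _; set h := m - z.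
have [h00|h0] := eqVneq h 0; first by rewrite h00 normr0 ltW.
have hp : 0 < `|h| by rewrite normr_gt0.
have tQ l : tame M (\1_(Q l) : H -> R) := tame_indic M (mQ l).
have tAQ l : tame M (\1_(A `&` Q l) : H -> R) := tame_indic M (mAQ l).
have tA : tame M (\1_A : H -> R) := tame_indic M mA.
have dotz : dot z h = \sum_(l < N) w l * dot (u l) h.
  rewrite /z; elim/big_ind2 : _ => //.
  - by rewrite -(scale0r 0) dotZl mul0r.
  - by move=> x1 x2 y1 y2 <- <-; rewrite dotDl.
  - by move=> l _; rewrite dotZl.
have td : tame M (fun x : H => \1_A x * dot x h).
  have := tame_ind mA (tame_dot dot_norm M_gt0 0 h).
  by under eq_fun do rewrite subr0.
have mE : prob P A * dot m h = Ex (fun x => \1_A x * dot x h).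
  have := cA h => /= c0; rewrite mulrC -(E_indic PM mA) -(EZ P _ tA).
  rewrite -[LHS]addr0 -c0 -ED; first last.
  - by apply: tame_ind => //; exact: tame_dot.
  - exact: tameZ.
  by apply: eq_E => x _; rewrite dotBl; ring.
have ts : tame M (fun x : H => \sum_(l < N) dot (u l) h * \1_(A `&` Q l) x).
  by apply: tame_sum => l; exact: tameZ.
have zE : prob P A * dot z h = Ex (fun x => \sum_(l < N) dot (u l) h * \1_(A `&` Q l) x).
  rewrite (E_sum PM); last by move=> l; exact: tameZ.
  rewrite dotz mulr_sumr; apply: eq_bigr => l _.
  by rewrite EZ// E_indic// /w mulrC mulrAC divfK ?gt_eqF// mulrC.
have tsQ : tame M (fun x : H => \sum_(l < N) \1_(Q l) x) by exact: tame_sum.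
have tr : tame M (fun x : H => 1 - \sum_(l < N) \1_(Q l) x).
  by apply: tameB => //; exact: tame_cst.
(* test the centroid condition against the error h itself *)
have key : prob P A * `|h| ^+ 2 <=
    Ex (fun x => (e' * `|h|) * \1_A x + (M * `|h|) * (1 - \sum_(l < N) \1_(Q l) x)).
  rewrite -dot_norm {1}/h dotBl mulrBr mE zE -EB//.
  apply: le_E; [exact: tameB|by apply: tameD; exact: tameZ|].
  move=> x xM; have [[l Ql]|nQ] := pselect (exists l : 'I_N, Q l x).
    rewrite (bigD1 l)//= big1 ?addr0; last first.
      move=> l' l'l; rewrite indicE memNset ?mulr0// => -[_ Ql'].
      by move: l'l => /eqP; apply; apply: val_inj; exact: Qdisj Ql' Ql.
    rewrite (bigD1 l)//= big1 ?addr0; last first.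
      move=> l' l'l; rewrite indicE memNset// => Ql'.
      by move: l'l => /eqP; apply; apply: val_inj; exact: Qdisj Ql' Ql.
    rewrite !indicE in_setI [_ \in Q l]mem_set// andbT subrr mulr0 addr0.
    rewrite [_ * _ %:R in X in _ - X]mulrC -mulrBr mulrC -dotBl ler_wpM2r//.
    apply: le_trans (ler_norm _) _; apply: le_trans (cauchy_schwarz dot_norm _ _) _.
    by rewrite ler_wpM2r// Qu.
  rewrite [\sum_(l < N) \1_(Q l) x]big1; last first.
    by move=> l _; rewrite indicE memNset// => Ql; apply: nQ; exists l.
  rewrite big1; last first.
    by move=> l _; rewrite indicE memNset ?mulr0// => -[_ Ql]; apply: nQ; exists l.
  rewrite !subr0 mulr1 ler_wpDl ?mulr_ge0 ?indic_ge0 ?(ltW e'0)//.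
  apply: le_trans (ler_norm _) _; rewrite normrM (ger0_norm (indic_ge0 _ _)).
  apply: le_trans (_ : 1 * `|dot x h| <= _); first by rewrite ler_wpM2r ?indic_le1.
  by rewrite mul1r; apply: le_trans (cauchy_schwarz dot_norm _ _) _; rewrite ler_wpM2r.
move: key; rewrite (ED P (tameZ _ tA) (tameZ _ tr)) (EZ P _ tA) (EZ P _ tr).
rewrite (EB P (tame_cst M 1) tsQ) (E_cst PM).
rewrite (E_sum PM _ _ (F := fun l : 'I_N => \1_(Q l)) (fun l => tQ l)) (E_indic PM mA).
under [in X in _ * (1 - X)]eq_bigr do rewrite (E_indic PM (mQ _)).
set q := \sum_(l < N) _ => key.
have Mh : 0 <= M * `|h| by rewrite mulr_ge0// ltW.
have qe : 1 - q <= e' by rewrite -/q in QN; lra.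
have k2 : M * `|h| * (1 - q) <= M * `|h| * e' by rewrite ler_wpM2l.
have k3 : `|h| * (prob P A * `|h|) <= `|h| * (e' * prob P A + M * e').
  apply: le_trans (_ : prob P A * `|h| ^+ 2 <= _); first by rewrite expr2; lra.
  apply: le_trans key _; apply: le_trans (lerD (lexx _) k2) _; lra.
rewrite ler_pM2l// in k3.
have e1 : e' <= e / 2 by rewrite ge_min lexx.
have e2 : M * e' <= e * d / 2.
  have : e' <= e * d / (2 * M) by rewrite ge_min lexx orbT.
  rewrite ler_pdivlMr ?mulr_gt0//; lra.
have k4 : e' * prob P A <= e / 2 * prob P A by rewrite ler_wpM2r// ltW.
have k5 : e * d <= e * prob P A by rewrite ler_pM2l.
rewrite -(ler_pM2l A0); lra.
Qed.

End compactness.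

Section cluster_points.
Context {R : realType} {H : completeNormedModType R} {dot : {dot H for idfun}}.
Hypothesis dot_norm : forall x : H, dot x x = `|x| ^+ 2.
Context (M : R) (P : probability (borel H) R).
Hypothesis M_gt0 : 0 < M.
Hypothesis PM : P (cball M) = 1%E.
Hypothesis H_sep : separable H.
Local Notation heavy := (@heavy_centroids _ _ dot M P).


(** Along an ultrafilter the N weights of [heavy_centroids_approx] converge,
    being in [0, 1]; hence the points form a Cauchy filter, and H is
    complete. *)
Lemma heavy_ultra_cvg (d : R) (T : Type) (F : set_system T) (f : T -> H) :
  0 < d -> UltraFilter F -> F (f @^-1` heavy d) -> cvg (f @ F).
Proof.
move=> d0 UF FT; apply: cauchy_cvg; apply: cauchy_exP => e e0.
have e20 : 0 < e / 2 by rewrite divr_gt0.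
have [u [N uP]] := heavy_centroids_approx dot_norm M_gt0 PM H_sep d0 e20.
have /choice[w wP] t : exists w : nat -> R, (forall l, 0 <= w l <= 1) /\
    (heavy d (f t) -> `|f t - \sum_(l < N) w l *: u l| <= e / 2).
  have [/uP[w [w01 wt]]|nt] := pselect (heavy d (f t)); first by exists w.
  by exists (fun=> 0); split => // _; rewrite lexx ler01.
have cvw l : cvg ((fun t => w t l) @ F).
  have := @segment_compact R 0 1.
  rewrite compact_ultra => /(_ _ (ultra_fmap (fun t => w t l) UF)).
  case=> [|o [_ ho]]; last by apply/cvg_ex; exists o.
  apply: (@filterE _ F _ ((fun t => w t l) @^-1` `[0, 1]%classic)) => t.
  by rewrite /= in_itv; exact: (wP t).1.
have cvz : cvg ((fun t => \sum_(l < N) w t l *: u l) @ F).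
  apply/cvg_ex; exists (\sum_(l < N) lim ((fun t => w t l) @ F) *: u l).
  apply: cvg_big => [|l _]; first exact: add_continuous.
  by apply: cvgZr_tmp; exact: cvw.
set z := lim ((fun t => \sum_(l < N) w t l *: u l) @ F) in cvz.
exists z => /=.
have := cvz; move=> /cvgrPdist_lt /(_ _ e20) cvz'.
apply: filterS2 cvz' FT => t zt ft; rewrite -ball_normE /ball_ /=.
have h1 := (wP t).2 ft.
rewrite -(subrK (\sum_(l < N) w t l *: u l) z) -addrA.
by apply: le_lt_trans (ler_normD _ _) _; rewrite [X in _ + X < _]distrC; lra.
Qed.

Lemma codebook_norm_lt k (c : 'I_k -> H) (e : R) : (0 < k)%N ->
  (forall i, `|c i| < e / k%:R) -> codebook_norm c < e.
Proof.
move=> k0 ce; have kr0 : 0 < k%:R :> R by rewrite ltr0n.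
have e0 : 0 < e.
  by have := le_lt_trans (normr_ge0 _) (ce (Ordinal k0)); rewrite pmulr_lgt0// invr_gt0.
rewrite -(@ltr_pXn2r _ 2) ?nnegrE ?codebook_norm_ge0 ?(ltW e0)//.
rewrite sqr_codebook_norm.
apply: lt_le_trans (_ : \sum_(i < k) (e / k%:R) ^+ 2 <= _).
  apply: ltr_sum; first by apply/hasP; exists (Ordinal k0); rewrite ?mem_index_enum.
  by move=> i _; rewrite ltr_pXn2r ?nnegrE ?divr_ge0 ?(ltW e0)//.
rewrite sumr_const card_ord -[X in _ <= X ^+ 2](divfK (lt0r_neq0 kr0) e).
move: (e / k%:R) => q; rewrite exprMn -[X in X <= _]mulr_natr.
by rewrite ler_wpM2l ?sqr_ge0// expr2 ler_peMr ?ler0n// ler1n.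
Qed.

Definition heavy_codebooks (k : nat) (d : R) : set ('I_k -> H) :=
  [set c | forall i, heavy d (c i)].

Lemma heavy_in_ball k d (c : 'I_k -> H) : 0 < d -> heavy_codebooks d c -> in_ball M c.
Proof.
move=> d0 hc; apply/in_ballE => i; have [A [mA dA cA]] := hc i.
exact: centroid_ball (lt_le_trans d0 dA) cA.
Qed.

Lemma heavy_cluster k d (F : set_system ('I_k -> H)) : (0 < k)%N -> 0 < d ->
  ProperFilter F -> F (heavy_codebooks d) ->
  exists2 c, in_ball M c & forall B (e : R), F B -> 0 < e ->
    exists2 c', B c' & codebook_norm (c' - c) < e.
Proof.
move=> k0 d0 PF Fh; have [G [UG FG]] := ultraFilterLemma PF.
have PG : ProperFilter G by exact: ultra_proper.
have FG0 : Filter G by exact: filter_filter.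
have cv i : cvg ((fun c : 'I_k -> H => c i) @ G).
  by apply: heavy_ultra_cvg d0 UG _; apply: filterS (FG _ Fh) => c; exact.
pose c := fun i => lim ((fun c : 'I_k -> H => c i) @ G).
have clus B (e : R) : F B -> 0 < e -> exists2 c', B c' & codebook_norm (c' - c) < e.
  move=> FB e0; have ek : 0 < e / k%:R by rewrite divr_gt0// ltr0n.
  have Gc : G [set c' | forall i, `|c i - c' i| < e / k%:R].
    by apply: filter_forall => i; have := cv i => /cvgrPdist_lt /(_ _ ek).
  have [c' [Bc' h]] := filter_ex (filterI (FG _ FB) Gc).
  exists c' => //; apply: codebook_norm_lt => // i.
  by have := h i; rewrite distrC.
exists c => //; apply/in_ballE => i; apply/ler_addgt0Pr => e e0.
have [c' /(heavy_in_ball d0) /in_ballE /(_ i) c'M c'c] := clus _ _ Fh e0.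
rewrite -(subrK (c' i) (c i)); apply: le_trans (ler_normD _ _) _.
have := le_codebook_norm (c' - c) i; rewrite /= distrC => h.
by rewrite addrC lerD// ltW// (le_lt_trans _ c'c).
Qed.

(** The minimizer is only a limit of elements of A; conditions closed under
    limits, such as staying away from given codebooks, pass to it. *)
Lemma heavy_min k d (A : set ('I_k -> H)) : (0 < k)%N -> 0 < d -> A !=set0 ->
  A `<=` heavy_codebooks d ->
  exists c, [/\ in_ball M c,
    forall e : R, 0 < e -> exists2 c', A c' & codebook_norm (c' - c) < e
  & forall c', A c' -> risk P c <= risk P c'].
Proof.
move=> k0 d0 A0 Ah; pose S := [set risk P c | c in A].
have infS : has_inf S.
  split; first by case: A0 => c Ac; exists (risk P c), c.
  exists 0 => _ [c Ac <-]; rewrite (risk_E M_gt0 PM k0).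
  by apply: E_ge0 => x _; exact: contrast_ge0.
pose L e := [set c | A c /\ risk P c < inf S + e].
pose F := minimizing_filter A (risk P).
have PF : ProperFilter F by exact: minimizing_filter_proper.
have FL e : 0 < e -> F (L e) by move=> e0; exists e.
have FA : F A by exists 1 => // c [].
have [|c cM cP] := @heavy_cluster k d F k0 d0 PF.
  by apply: filterS FA; exact: Ah.
exists c; split => // [e e0|c' Ac']; first exact: cP.
apply: (@le_trans _ _ (inf S)); last by apply: ge_inf; [exact: infS.2|exists c'].
apply/ler_addgt0Pr => e e0.
have e20 : 0 < e / 2 by rewrite divr_gt0.
have r0 : 0 < e / 2 / (4 * M) by rewrite divr_gt0// mulr_gt0.
have [b [Ab bL] bc] := cP _ _ (FL _ e20) r0.
have bM := heavy_in_ball d0 (Ah _ Ab).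
have := risk_lip M_gt0 PM k0 cM bM; rewrite codebook_normB.
move: bc; rewrite ltr_pdivlMr ?mulr_gt0// => bc h; lra.
Qed.

(** An infinite A would contain a sequence of distinct codebooks, which has
    a cluster point, contradicting the separation. *)
Lemma heavy_separated_finite k d (A : set ('I_k -> H)) (r : R) : (0 < k)%N -> 0 < d -> 0 < r ->
  A `<=` heavy_codebooks d ->
  (forall c c', A c -> A c' -> codebook_norm (c - c') < r -> c = c') ->
  finite_set A.
Proof.
move=> k0 d0 r0 Ah Asep; apply: contrapT => /infiniteP /pcard_leP[f].
have fA n : A (f n) by exact: funS.
have finj m n : f m = f n -> m = n by apply: inj; rewrite inE.
pose F : set_system ('I_k -> H) := (f : nat -> 'I_k -> H) @ \oo.
have FA : F A by exists 0%N => // n _; exact: fA.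
have [|c _ cP] := @heavy_cluster k d F k0 d0 _.
  by apply: filterS FA; exact: Ah.
have r20 : 0 < r / 2 by rewrite divr_gt0.
have FT (N : nat) : F (f @` [set m | (N < m)%N]).
  by exists N.+1 => // n /= Nn; exists n.
have [_ [n _ <-] nc] := cP _ _ (FT 0%N) r20.
have [_ [m nm <-] mc] := cP _ _ (FT n) r20.
have /finj mn : f m = f n.
  apply: Asep => //; apply: le_lt_trans (ler_dist_codebook_norm _ c _) _.
  by rewrite (codebook_normB c); lra.
by move: nm; rewrite /= mn ltnn.
Qed.


End cluster_points.

(** * Existence of optimal codebooks *)

Section existence.
Context {R : realType} {H : completeNormedModType R} {dot : {dot H for idfun}}.
Hypothesis dot_norm : forall x : H, dot x x = `|x| ^+ 2.
Context (M : R) (P : probability (borel H) R).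
Hypothesis M_gt0 : 0 < M.
Hypothesis PM : P (cball M) = 1%E.
Hypothesis H_sep : separable H.
Local Notation heavy_codebooks := (@heavy_codebooks _ _ dot M P).

Definition extend n (b : 'I_n -> H) (z : H) : 'I_n.+1 -> H :=
  fun i => oapp b z (unlift ord0 i).

Lemma extend0 n (b : 'I_n -> H) z : extend b z ord0 = z.
Proof. by rewrite /extend unlift_none. Qed.

Lemma drop_extend n (b : 'I_n -> H) z : drop_center (extend b z) ord0 = b.
Proof. by apply/funext => j; rewrite /drop_center /extend liftK. Qed.

(** On the ball of radius |z - b j0| / 4 around z, which P charges, the new
    centre lowers the contrast by at least |z - b j0|^2 / 2, where b j0 is the
    centre nearest to z. *)
Lemma risk_extend_lt n (b : 'I_n -> H) z : (0 < n)%N -> measure_support P z ->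
  (forall j, z != b j) -> risk P (extend b z) < risk P b.
Proof.
move=> n0 zP zb; set c := extend b z.
have [j0 bz] := contrastP b z n0.
set e := `|z - b j0|.
have e0 : 0 < e by rewrite normr_gt0 subr_eq0.
have emin j : e <= `|z - b j|.
  by have := contrast_le b z j; rewrite bz ler_pXn2r ?nnegrE.
pose U : set (borel H) := ball z (e / 4).
have oU : open (U : set H) by exact: ball_open.
have mU : measurable U := open_borel oU.
have U0 : 0 < prob P U.
  rewrite -lte_fin -probE//; apply: zP => //; apply: ballxx.
  by rewrite divr_gt0.
have tU : tame M (\1_U : H -> R) := tame_indic M mU.
have tc := tame_contrast M_gt0 (ltn0Sn n) c.
have tb := tame_contrast M_gt0 n0 b.
apply: lt_le_trans (_ : risk P c + e ^+ 2 / 2 * prob P U <= _).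
  by rewrite ltrDl mulr_gt0// divr_gt0// exprn_gt0.
rewrite (risk_E M_gt0 PM (ltn0Sn n)) (risk_E M_gt0 PM n0) -(E_indic PM mU) -(EZ P _ tU).
rewrite -(ED P tc (tameZ _ tU)).
apply: le_E; [exact: tameD tc (tameZ _ tU)|exact: tb|] => x xM.
have [Ux|nUx] := pselect (U x); last first.
  rewrite indicE memNset// mulr0 addr0 -(drop_extend b z); exact: contrast_drop_ge.
rewrite indicE mem_set// mulr1.
have h1 : contrast c x <= `|x - z| ^+ 2.
  by have := contrast_le c x ord0; rewrite /c extend0.
have [j bx] := contrastP b x n0; rewrite bx.
have xz : `|x - z| < e / 4 by move: Ux; rewrite /U -ball_normE /ball_ /= distrC.
have h2 : e <= `|x - b j| + `|x - z|.
  apply: le_trans (emin j) _; apply: le_trans (ler_normB _ _).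
  by rewrite opprB [X in _ <= `|X|]addrC addrA subrK.
have := normr_ge0 (x - z); have := normr_ge0 (x - b j).
move: (`|x - z|) (`|x - b j|) xz h1 h2 => p q pe h1 h2 q0 p0.
have : (3 / 4 * e) ^+ 2 <= q ^+ 2 by rewrite ler_pXn2r ?nnegrE//; lra.
have : p ^+ 2 <= (e / 4) ^+ 2 by rewrite ler_pXn2r ?nnegrE//; lra.
by rewrite !exprMn => h3 h4; lra.
Qed.

(** The mass bound is uniform over all codebooks of risk at most r, so
    Lloyd's step sends all of them into one precompact set. *)
Lemma lloyd_heavy n (rho r : R) (c : 'I_n.+1 -> H) : (0 < n)%N ->
  (forall b : 'I_n -> H, rho <= risk P b) -> r < rho -> in_ball M c -> risk P c <= r ->
  exists2 m : 'I_n.+1 -> H, heavy_codebooks ((rho - r) / (4 * M ^+ 2)) m &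
    forall i, @centroid _ _ dot M P (cell c i) (m i).
Proof.
move=> n0 rhoP rrho cM cr.
have M4 : 0 < 4 * M ^+ 2 by rewrite mulr_gt0// exprn_gt0.
have mass i : (rho - r) / (4 * M ^+ 2) <= prob P (cell c i).
  rewrite ler_pdivrMr// mulrC.
  by have := cell_mass_lb M_gt0 PM n0 rhoP i cM; lra.
have [|m mP] := @lloyd_exists _ _ _ dot_norm M P M_gt0 PM _ c.
  move=> i; apply: lt_le_trans (mass i).
  by rewrite divr_gt0// subr_gt0.
exists m => // i; exists (cell c i); split => //; exact: measurable_cell.
Qed.

Lemma injection_avoids N n (f : 'I_N -> H) (b : 'I_n -> H) : injective f ->
  (n < N)%N -> exists i, forall j, f i != b j.
Proof.
move=> finj nN; apply: contrapT => /forallNP h.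
have /choice[g gP] i : exists j, f i = b j.
  by apply: contrapT => /forallNP h'; apply: (h i) => j; apply/eqP; exact: h'.
have ginj : injective g by move=> i j gij; apply: finj; rewrite !gP gij.
by have := leq_card g ginj; rewrite !card_ord leqNgt nN.
Qed.

(** Induction on the number of centres: a further support point strictly
    lowers the optimal risk, so codebooks that beat n centres with n + 1 have
    heavy cells, Lloyd's step makes them heavy codebooks, and the risk attains
    its minimum there. *)
Lemma optimal_exists N (f : 'I_N -> H) n : injective f ->
  (forall i, measure_support P (f i)) -> (0 < n)%N -> (n <= N)%N ->
  exists2 b : 'I_n -> H, optimal n P b & in_ball M b.
Proof.
move=> finj fP; elim: n => // -[_ _ _|n IH _ nN].
  have p1 : prob P setT = 1 by rewrite /prob probability_setT.
  have [|m cm] := @centroid_exists _ _ _ dot_norm M P M_gt0 PM setT measurableT.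
    by rewrite p1.
  have cellT (c : 'I_1 -> H) : cell c ord0 = setT.
    by apply/seteqP; split => // x _ j; rewrite !ord1 ltnn.
  exists (fun=> m); last first.
    by apply/in_ballE => i; apply: centroid_ball cm => //; rewrite p1.
  move=> c; rewrite !(risk_cost M_gt0 PM (ltn0Sn 0)) /cost !big_ord1 !cellT.
  rewrite (centroid_inertia dot_norm M_gt0 PM (c ord0) measurableT cm) lerDl.
  by rewrite mulr_ge0 ?prob_ge0 ?sqr_ge0.
have [b bopt bM] := IH isT (ltnW nN).
have [i fb] := injection_avoids b finj nN.
have n0 := ltn0Sn n; have n1 := ltn0Sn n.+1.
have c1lt := risk_extend_lt n0 (fP i) fb.
have [c1 [c1M c1r _]] := ball_retract_codebook dot_norm M_gt0 PM n1 (extend b (f i)).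
have {c1r c1lt} c1lt : risk P c1 < risk P b := le_lt_trans c1r c1lt.
(* c1 beats b, so the codebooks no worse than c1 have cells of mass at least d *)
pose d := (risk P b - risk P c1) / (4 * M ^+ 2).
have d0 : 0 < d by rewrite divr_gt0 ?subr_gt0// mulr_gt0// exprn_gt0.
have heavy_le (c : 'I_n.+2 -> H) : risk P c <= risk P c1 ->
    exists2 m : 'I_n.+2 -> H, heavy_codebooks d m & risk P m <= risk P c.
  move=> cr; have [c' [c'M c'r _]] := ball_retract_codebook dot_norm M_gt0 PM n1 c.
  have [m hm mP] := lloyd_heavy n0 bopt c1lt c'M (le_trans c'r cr).
  by exists m => //; apply: le_trans c'r; exact: lloyd_risk mP.
have [m1 hm1 m1r] := heavy_le c1 (lexx _).
have [||c [cM _ cmin]] :=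
  @heavy_min _ _ _ dot_norm M P M_gt0 PM H_sep _ d (heavy_codebooks d) n1 d0.
- by exists m1.
- by [].
exists c => // c'; have [cr|/ltW rc] := leP (risk P c') (risk P c1).
  by have [m /cmin h1 h2] := heavy_le _ cr; exact: le_trans h1 h2.
exact: le_trans (le_trans (cmin _ hm1) m1r) rc.
Qed.

(** A centre at distance 5 M captures no point of the ball, even after
    every centre has moved by less than M; so near this codebook the risk is
    that of the other n centres at least. In particular local minimizers that
    are not optimal exist. *)
Lemma far_local_minimizer n (b : 'I_n -> H) (y : H) : (0 < n)%N -> y != 0 ->
  optimal n P b -> in_ball M b ->
  exists2 c : 'I_n.+1 -> H, local_minimizer P c & risk P c = risk P b.
Proof.
move=> n0 y0 bopt /in_ballE bM.
pose z := (5 * M / `|y|) *: y.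
have zn : `|z| = 5 * M.
  by rewrite normrZ ger0_norm ?divr_ge0 ?mulr_ge0 ?(ltW M_gt0)// divfK// normr_eq0.
pose c := extend b z; pose j := Ordinal n0.
have n1 := ltn0Sn n.
have far c' : codebook_norm (c' - c) < M -> risk P (drop_center c' ord0) <= risk P c'.
  move=> c'c; rewrite (risk_E M_gt0 PM n0) (risk_E M_gt0 PM n1).
  apply: le_E; [exact: tame_contrast|exact: tame_contrast|] => x xM.
  have [i ->] := contrastP c' x n1.
  have [->|i0] := eqVneq i ord0; last first.
    have i0' : ord0 != i by rewrite eq_sym.
    have [l il _] := unlift_some i0'.
    by rewrite il; exact: contrast_le.
  apply: le_trans (contrast_le _ x j) _; rewrite ler_pXn2r ?nnegrE//.
  have h0 := le_lt_trans (le_codebook_norm _ ord0) c'c.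
  have h1 := le_lt_trans (le_codebook_norm _ (lift ord0 j)) c'c.
  change (is_true (`|c' ord0 - c ord0| < M)) in h0.
  change (is_true (`|c' (lift ord0 j) - c (lift ord0 j)| < M)) in h1.
  have cj : c (lift ord0 j) = b j by rewrite -[RHS](congr1 (@^~ j) (drop_extend b z)).
  rewrite cj in h1; rewrite [c ord0]extend0 in h0.
  have bj := bM j.
  set p := c' (lift ord0 j) in h1 *; set q := c' ord0 in h0 *.
  have k1 : `|p| <= `|p - b j| + `|b j| by rewrite -{1}(subrK (b j) p) ler_normD.
  have k2 : `|x - p| <= `|x| + `|p| := ler_normB x p.
  have k3 : `|z| <= `|q| + `|q - z| by rewrite -{1}(subKr q z) ler_normB.
  have k4 : `|q| <= `|x| + `|x - q| by rewrite -{1}(subKr x q) ler_normB.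
  change (is_true (`|x - p| <= `|x - q|)); lra.
have crb : risk P c <= risk P b.
  rewrite (risk_E M_gt0 PM n0) (risk_E M_gt0 PM n1).
  apply: le_E; [exact: tame_contrast|exact: tame_contrast|] => x xM.
  by rewrite -(drop_extend b z); exact: contrast_drop_ge.
have bmin c' : codebook_norm (c' - c) < M -> risk P b <= risk P c'.
  by move=> /far; exact: le_trans (bopt _).
exists c; first by exists M => // c' /bmin; exact: le_trans.
apply/eqP; rewrite eq_le crb bmin//.
by rewrite subrr /codebook_norm big1 ?sqrtr0// => i _; rewrite normr0 expr0n.
Qed.

End existence.

(** * Points near cell boundaries *)

Section geometry.
Context {R : realType} {H : completeNormedModType R} {dot : {dot H for idfun}}.
Hypothesis dot_norm : forall x : H, dot x x = `|x| ^+ 2.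

(** Walk from x in the direction c j - c i. The difference of the squared
    distances to c l and c i is affine along the way and decreases when
    a l > 0; at the first time s l0 when one of these differences vanishes the
    point is in the cells of both i and l0. This time is at most s j, which
    gives the bound. *)
Lemma boundary_near k (c : 'I_k -> H) (x : H) i j : voronoi c i x -> c i != c j ->
  exists2 y, boundary c y &
    2 * `|c j - c i| * `|x - y| <= `|x - c j| ^+ 2 - `|x - c i| ^+ 2.
Proof.
move=> xi cij; pose v := c j - c i.
have v0 : 0 < `|v| ^+ 2.
  by rewrite exprn_gt0// normr_gt0 subr_eq0 eq_sym.
pose g l := `|x - c l| ^+ 2 - `|x - c i| ^+ 2.
pose a l := dot v (c l - c i).
have xil l : `|x - c i| <= `|x - c l|.
  by have [->|li] := eqVneq l i; [exact: lexx|exact: xi].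
have g0 l : 0 <= g l by rewrite subr_ge0 ler_pXn2r ?nnegrE.
have aj : a j = `|v| ^+ 2 by rewrite /a dot_norm.
pose s l := g l / (2 * a l).
have pj : 0 < a j by rewrite aj.
case: (@arg_minP _ _ _ j (fun l => 0 < a l) s pj) => l0 al0 l0min.
have s0 : 0 <= s l0 by rewrite divr_ge0 ?mulr_ge0 ?(ltW al0).
pose y := x + s l0 *: v.
have yE l : `|y - c l| ^+ 2 - `|y - c i| ^+ 2 = g l - 2 * s l0 * a l.
  have sq m : `|y - c m| ^+ 2 =
      `|x - c m| ^+ 2 + 2 * s l0 * dot v (x - c m) + s l0 ^+ 2 * `|v| ^+ 2.
    rewrite /y addrAC; move: (x - c m) => u.
    by rewrite (sqr_normD dot_norm) dotZr normrZ exprMn (ger0_norm s0) (dotC u); ring.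
  rewrite !sq /g /a !dotBr; ring.
have yge l : 0 <= `|y - c l| ^+ 2 - `|y - c i| ^+ 2.
  rewrite yE subr_ge0; have [al|al] := ltP 0 (a l).
    have := l0min _ al; rewrite {2}/s ler_pdivlMr ?mulr_gt0// => h; lra.
  apply: le_trans (g0 l); rewrite -mulrA mulr_ge0_le0// mulr_ge0_le0//.
have yl0 : `|y - c l0| = `|y - c i|.
  have : `|y - c l0| ^+ 2 - `|y - c i| ^+ 2 = 0.
    rewrite yE; have : s l0 * (2 * a l0) = g l0 by rewrite /s divfK// gt_eqF// mulr_gt0.
    by lra.
  by move=> /eqP; rewrite subr_eq0 eqrXn2// => /eqP.
have yi l : `|y - c i| <= `|y - c l|.
  by have := yge l; rewrite subr_ge0 ler_pXn2r ?nnegrE.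
have il0 : i != l0.
  apply/eqP => il0; move: al0; rewrite -il0 /a subrr.
  by rewrite -(scale0r (0 : H)) dotZr mul0r ltxx.
exists y.
  exists (i, l0) => //=; split => l _ //.
  by rewrite yl0.
have -> : x - y = - (s l0 *: v) by rewrite /y opprD addrA subrr add0r.
rewrite normrN normrZ ger0_norm// -/v -/(g j).
have := l0min _ pj; rewrite {2}/s ler_pdivlMr ?mulr_gt0// aj => h.
by apply: le_trans h; rewrite expr2; lra.
Qed.

(** Since the projection on C exists, the enlargement is the set of points
    at distance at most t from C. In infinite dimension the sum of a closed set
    and a closed ball need not be closed, so convexity matters. *)
Lemma enlargement_closed (C : set H) (t : R) : closed C ->
  (forall y z, C y -> C z -> C (2^-1 *: (y + z))) -> closed (enlargement C t).
Proof.
move=> Ccl Cmid x clx.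
have [C0|nC] := pselect (C !=set0); last first.
  have [z [[a Ca _] _]] := clx _ (nbhsx_ballx x 1 ltr01).
  by exfalso; apply: nC; exists a.
have [y Cy ymin] := closed_convex_proj dot_norm x Ccl C0 Cmid.
exists y => //; rewrite /closed_ball_ /= distrC; apply/ler_addgt0Pr => e e0.
have [z [[a Ca az] xz]] := clx _ (nbhsx_ballx x e e0).
apply: le_trans (ymin _ Ca) _.
rewrite -(subrK z x) -addrA; apply: le_trans (ler_normD _ _) _.
rewrite [X in _ <= X]addrC; apply: lerD; last by rewrite distrC.
by apply/ltW; move: xz; rewrite -ball_normE.
Qed.

Lemma voronoi_mid k (c : 'I_k -> H) i y z : voronoi c i y -> voronoi c i z ->
  voronoi c i (2^-1 *: (y + z)).
Proof.
move=> yi zi l li.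
have half w : `|w - c i| <= `|w - c l| <-> 0 <= `|c l| ^+ 2 - `|c i| ^+ 2 - 2 * dot w (c l - c i).
  rewrite -(@ler_pXn2r _ 2) ?nnegrE// !(sqr_normB dot_norm) dotBr.
  by split => h; lra.
apply/half; have /half := yi l li; have /half := zi l li.
by rewrite dotZl dotDl; lra.
Qed.

(** The boundary is a finite union of intersections of two Voronoi cells,
    which are closed and convex. *)
Lemma measurable_enlargement k (c : 'I_k -> H) t :
  measurable (enlargement (boundary c) t : set (borel H)).
Proof.
have -> : enlargement (boundary c) t =
    \bigcup_(ij in [set ij : 'I_k * 'I_k | ij.1 != ij.2])
      enlargement (voronoi c ij.1 `&` voronoi c ij.2) t.
  apply/seteqP; split => x.
    by case=> a [ij ne aij] ax; exists ij => //; exists a.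
  by case=> ij ne [a aij ax]; exists a => //; exists ij.
apply: fin_bigcup_measurable; first exact: finite_finset.
move=> ij _; apply: closed_borel; apply: enlargement_closed.
  by apply: closedI; exact: voronoi_closed.
by move=> y z [y1 y2] [z1 z2]; split; exact: voronoi_mid.
Qed.

End geometry.

Lemma sqrt2_gt0 (R : realType) : 0 < Num.sqrt 2 :> R.
Proof. by rewrite sqrtr_gt0. Qed.

(** * Consequences of the margin condition *)

Section margin.
Context {R : realType} {H : completeNormedModType R} {dot : {dot H for idfun}}.
Hypothesis dot_norm : forall x : H, dot x x = `|x| ^+ 2.
Context {M r0 : R} {P : probability (borel H) R} {k : nat}.
Hypothesis M_gt0 : 0 < M.
Hypothesis r0_gt0 : 0 < r0.
Hypothesis PM : P (cball M) = 1%E.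
Hypothesis k_ge2 : (2 <= k)%N.
Local Notation B := (min_dist k P).
Local Notation pm := (p_min k P).
Local Notation enl c t := (enlargement (boundary c) t).
Local Notation centroid := (@centroid _ _ dot M P).
Implicit Types c cs : 'I_k -> H.
Hypothesis optM : forall cs, optimal k P cs -> in_ball M cs.
Hypothesis B_gt0 : 0 < B.
Hypothesis pmP : forall t, 0 <= t <= r0 ->
  p_margin k P t <= B * pm / (128 * M ^+ 2) * t.

Local Notation k_gt0 := (ltnW k_ge2 : (0 < k)%N).
Local Notation two := (Num.sqrt 2 : R).

Lemma min_dist_le cs i j : optimal k P cs -> i != j -> B <= `|cs i - cs j|.
Proof.
move=> ocs ij; apply: ge_inf; last by exists cs, i, j.
by exists 0 => _ [c [i' [j' [_ _ ->]]]].
Qed.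

Lemma p_min_le cs i : optimal k P cs -> pm <= prob P (voronoi cs i).
Proof.
move=> ocs; apply: ge_inf; last by exists cs, i.
by exists 0 => _ [c [i' [_ ->]]]; exact: prob_ge0.
Qed.

Lemma p_min_ge0 : 0 <= pm.
Proof.
rewrite /p_min; set S := [set p | _].
have [->|/set0P S0] := eqVneq S set0; first by rewrite inf0.
by apply: lb_le_inf => // _ [c [i' [_ ->]]]; exact: prob_ge0.
Qed.

Lemma prob_enl_le cs t : optimal k P cs -> 0 <= t <= r0 ->
  prob P (enl cs t) <= B * pm / (128 * M ^+ 2) * t.
Proof.
move=> ocs tr; apply: le_trans (pmP tr); apply: sup_upper_bound; last by exists cs.
split; first by exists (prob P (enl cs t)), cs.
exists 1 => _ [c _ <-]; apply: prob_le1; exact: measurable_enlargement.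
Qed.

(** [p_min] concerns closed Voronoi cells, which exceed the partition cells
    only by boundary points; the margin condition at t = 0 makes these null. *)
Lemma cell_mass cs i : optimal k P cs -> pm <= prob P (cell cs i).
Proof.
move=> ocs; apply: le_trans (p_min_le i ocs) _.
have mV : measurable (voronoi cs i : set (borel H)).
  by apply: closed_borel; exact: voronoi_closed.
have mE : measurable (enl cs 0 : set (borel H)) by exact: measurable_enlargement.
have mc := measurable_cell cs i.
have e0 : prob P (enl cs 0) <= 0.
  by have := @prob_enl_le cs 0 ocs; rewrite mulr0 lexx (ltW r0_gt0); exact.
suff : prob P (voronoi cs i) <= prob P (cell cs i) + prob P (enl cs 0) by lra.
have t1 := tame_indic M mV; have t2 := tame_indic M mE; have t3 := tame_indic M mc.
rewrite -(E_indic PM mV) -(E_indic PM mE) -(E_indic PM mc) -(ED P t3 t2).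
apply: le_E; [exact: t1|exact: tameD|] => x _.
have [xV|xV] := pselect (voronoi cs i x); last first.
  by rewrite indicE memNset// addr_ge0 ?indic_ge0.
rewrite indicE mem_set//.
have [j cj] := cell_ex cs x k_gt0.
have [ij|ij] := eqVneq i j.
  by rewrite [\1_(cell cs i) x]indicE mem_set ?ij// lerDl indic_ge0.
rewrite [\1_(enl cs 0) x]indicE mem_set ?lerDr ?indic_ge0//.
exists x; last by rewrite /closed_ball_ /= subrr normr0.
by exists (i, j) => //; split => //=; exact: cell_voronoi.
Qed.

(** Passing between c and cs changes |x - c i|^2 by at most 4 M |c i - cs i|.
    So when cs sends x to i but c sends it to j, the distances of x to cs i and
    cs j nearly agree and x is near the boundary, by [boundary_near]; off the
    enlarged boundary i and j coincide and both differences vanish. The factor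
    sqrt 2 bounds the sum of two norms by a codebook norm. *)
Lemma disagreement cs c x i j : optimal k P cs -> in_ball M c -> `|x| <= M ->
  cell cs i x -> cell c j x ->
  let L := 4 * two * M * codebook_norm (c - cs) in
  `|x - c i| ^+ 2 - `|x - c j| ^+ 2 <= L * \1_(enl cs (L / (2 * B))) x /\
  `|x - cs j| ^+ 2 - `|x - cs i| ^+ 2 <= L * \1_(enl cs (L / (2 * B))) x.
Proof.
move=> ocs cM xM xi xj; set L := _ * codebook_norm _ => /=.
have L0 : 0 <= L by rewrite !mulr_ge0 ?codebook_norm_ge0 ?(ltW M_gt0) ?(ltW (sqrt2_gt0 R)).
have [<-|ij] := eqVneq i j; first by rewrite !subrr mulr_ge0 ?indic_ge0.
move/in_ballE : cM => cM; have /in_ballE csM := optM ocs.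
have M40 : 0 < 4 * M by rewrite mulr_gt0.
have dL : 4 * M * (`|c i - cs i| + `|c j - cs j|) <= L.
  have := le_codebook_norm2 (c - cs) ij; rewrite -(ler_pM2l M40) => h.
  by apply: le_trans h _; rewrite /L; lra.
have h1 := sqd_lip xM (cM i) (csM i).
have h2 := sqd_lip xM (csM j) (cM j); rewrite (distrC (cs j)) in h2.
have h3 : `|x - c j| ^+ 2 <= `|x - c i| ^+ 2 by rewrite ler_pXn2r ?nnegrE// cell_le.
have h4 : `|x - cs i| ^+ 2 <= `|x - cs j| ^+ 2 by rewrite ler_pXn2r ?nnegrE// cell_le.
have xb : `|x - cs j| ^+ 2 - `|x - cs i| ^+ 2 <= L by lra.
rewrite indicE mem_set ?mulr1; first by split; lra.
have csij : cs i != cs j.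
  by rewrite -subr_eq0 -normr_gt0; exact: lt_le_trans (min_dist_le ocs ij).
have [y yb yx] := boundary_near dot_norm (@cell_voronoi _ _ _ _ _ _ xi) csij.
exists y => //; rewrite /closed_ball_ /= distrC.
rewrite ler_pdivlMr ?mulr_gt0//.
have Bij : B <= `|cs j - cs i| by rewrite distrC; exact: min_dist_le.
apply: le_trans xb; apply: le_trans yx.
by rewrite [X in _ <= X]mulrC ler_wpM2l// ler_pM2l.
Qed.

(** Integrating [disagreement], the excess is at most L times the mass of
    the enlargement by t = L / (2 B), which by the margin condition is at most
    pm L^2 / (256 M^2), and L^2 = 32 M^2 |c - cs|^2. *)
Lemma disagreement_cost cs c : optimal k P cs -> in_ball M c ->
  codebook_norm (c - cs) <= B * r0 / (4 * two * M) ->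
  cost M P cs c <= risk P c + pm / 8 * codebook_norm (c - cs) ^+ 2 /\
  cost M P c cs <= risk P cs + pm / 8 * codebook_norm (c - cs) ^+ 2.
Proof.
move=> ocs cM cr; pose L := 4 * two * M * codebook_norm (c - cs).
have k0 : (0 < k)%N := k_gt0.
have M0 := M_gt0; have B0 := B_gt0; have T0 := sqrt2_gt0 R.
have L0 : 0 <= L by rewrite !mulr_ge0 ?codebook_norm_ge0 ?(ltW M_gt0) ?(ltW (sqrt2_gt0 R)).
pose t := L / (2 * B).
have tr : 0 <= t <= r0.
  apply/andP; split; first by apply: divr_ge0 => //; rewrite mulr_ge0// ltW.
  rewrite ler_pdivrMr ?mulr_gt0//.
  move: cr; rewrite ler_pdivlMr ?mulr_gt0// => h.
  have := mulr_gt0 B0 r0_gt0; rewrite /L; lra.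
have mE : measurable (enl cs t : set (borel H)) by exact: measurable_enlargement.
have tE := tame_indic M mE.
have Lp : L * prob P (enl cs t) <= pm / 8 * codebook_norm (c - cs) ^+ 2.
  have := ler_wpM2l L0 (prob_enl_le ocs tr) => /le_trans; apply.
  rewrite /t.
  have -> : L * (B * pm / (128 * M ^+ 2) * (L / (2 * B))) = pm * L ^+ 2 / (256 * M ^+ 2).
    by field; rewrite ?gt_eqF// ?mulr_gt0.
  have -> : L ^+ 2 = 32 * M ^+ 2 * codebook_norm (c - cs) ^+ 2.
    by rewrite /L !exprMn sqr_sqrtr ?ler0n//; ring.
  rewrite le_eqVlt; apply/orP; left; apply/eqP; by field; rewrite gt_eqF.
split.
- apply: le_trans (lerD (lexx _) Lp).
  rewrite (cost_E M_gt0 PM) (risk_E M_gt0 PM k_gt0) -(E_indic PM mE) -(EZ P _ tE).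
  rewrite -(ED P (tame_contrast M_gt0 k_gt0 c) (tameZ _ tE)).
  apply: le_E; [exact: tame_cost|apply: tameD; [exact: tame_contrast|exact: tameZ]|].
  move=> x xM; have [i xi] := cell_ex cs x k_gt0; have [j xj] := cell_ex c x k_gt0.
  rewrite (cell_sum (fun i => `|x - c i| ^+ 2) xi) (cell_contrast xj).
  have [h _] := disagreement ocs cM xM xi xj.
  by rewrite -/L -/t in h; rewrite -lerBlDl.
- apply: le_trans (lerD (lexx _) Lp).
  rewrite (cost_E M_gt0 PM) (risk_E M_gt0 PM k_gt0) -(E_indic PM mE) -(EZ P _ tE).
  rewrite -(ED P (tame_contrast M_gt0 k_gt0 cs) (tameZ _ tE)).
  apply: le_E; [exact: tame_cost|apply: tameD; [exact: tame_contrast|exact: tameZ]|].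
  move=> x xM; have [i xi] := cell_ex cs x k_gt0; have [j xj] := cell_ex c x k_gt0.
  rewrite (cell_sum (fun i => `|x - cs i| ^+ 2) xj) (cell_contrast xi).
  have [_ h] := disagreement ocs cM xM xi xj.
  by rewrite -/L -/t in h; rewrite -lerBlDl.
Qed.

(** The centres of cs are centroids, so [cost cs c] exceeds the risk of cs by
    the sum of mass * |c i - cs i|^2, which dominates the excess of
    [disagreement_cost]. *)
Lemma loss_ge cs c : optimal k P cs -> in_ball M c ->
  codebook_norm (c - cs) <= B * r0 / (4 * two * M) ->
  7 / 8 * pm * codebook_norm (c - cs) ^+ 2 <= loss P c cs.
Proof.
move=> ocs cM cr; have [h _] := disagreement_cost ocs cM cr.
have hc i : inertia M P (cell cs i) (c i) =
    inertia M P (cell cs i) (cs i) + prob P (cell cs i) * `|c i - cs i| ^+ 2.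
  apply: centroid_inertia => //; first exact: measurable_cell.
  exact: (local_minimizer_centroid dot_norm M_gt0 PM k_gt0 (optimal_local_minimizer ocs)).
have : risk P cs + pm * codebook_norm (c - cs) ^+ 2 <= cost M P cs c.
  rewrite /cost (eq_bigr _ (fun i _ => hc i)) big_split /= -/(cost M P cs cs).
  rewrite -(risk_cost M_gt0 PM k_gt0) lerD2l sqr_codebook_norm mulr_sumr.
  by apply: ler_sum => i _; rewrite ler_wpM2r ?sqr_ge0// cell_mass.
by rewrite /loss; lra.
Qed.

(** If c is stationary as well, the roles of c and cs can be exchanged:
    the risk of c is at most [cost c cs], hence at most the risk of cs up to
    pm / 8 |c - cs|^2, against the lower bound 7 / 8 of [loss_ge]. *)
Lemma stationary_close cs c : 0 < pm -> optimal k P cs -> in_ball M c ->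
  (forall i, centroid (cell c i) (c i)) ->
  codebook_norm (c - cs) <= B * r0 / (4 * two * M) -> c = cs.
Proof.
move=> pm0 ocs cM cc cr; have [_ h] := disagreement_cost ocs cM cr.
have h1 := loss_ge ocs cM cr; rewrite /loss in h1.
have h2 : risk P c <= cost M P c cs.
  rewrite (risk_cost M_gt0 PM k_gt0); apply: ler_sum => i _.
  rewrite (centroid_inertia dot_norm M_gt0 PM (cs i) (measurable_cell c i) (cc i)).
  by rewrite lerDl mulr_ge0 ?prob_ge0 ?sqr_ge0.
apply: codebook_norm0_eq; apply/eqP; rewrite -sqrf_eq0 eq_le sqr_ge0 andbT.
by rewrite -(ler_pM2l pm0) mulr0; lra.
Qed.

Lemma min_dist_le2M cs : optimal k P cs -> B <= 2 * M.
Proof.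
move=> ocs; have /in_ballE csM := optM ocs.
pose i := Ordinal k_gt0; pose j := Ordinal k_ge2.
apply: le_trans (min_dist_le (i := i) (j := j) ocs _) _ => //.
by apply: le_trans (ler_normB _ _) _; have := csM i; have := csM j; lra.
Qed.

Lemma p_min_le1 cs : optimal k P cs -> pm <= 1.
Proof.
move=> ocs; apply: le_trans (p_min_le (Ordinal k_gt0) ocs) _.
by apply: prob_le1; apply: closed_borel; exact: voronoi_closed.
Qed.

(** Every point of the ball is at distance at most 2 M from the boundary,
    so p(2 M) = 1, while the margin condition at 2 M would give
    p(2 M) <= 1 / 32. *)
Lemma margin_radius_lt cs : optimal k P cs -> r0 < 2 * M.
Proof.
move=> ocs; rewrite ltNge; apply/negP => Mr.
have M0 := M_gt0.
have tr : 0 <= 2 * M <= r0 by rewrite Mr mulr_ge0// ltW.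
have := prob_enl_le ocs tr; apply/negP; rewrite -ltNge.
have /in_ballE csM := optM ocs.
have -> : prob P (enl cs (2 * M)) = 1.
  apply/eqP; rewrite eq_le prob_le1 /=; last exact: measurable_enlargement.
  apply: (@le_trans _ _ (prob P (cball M))); first by rewrite /prob PM.
  apply: le_prob; [exact: measurable_cball|exact: measurable_enlargement|].
  move=> x xM; have [i xi] := cell_ex cs x k_gt0.
  have [j ij] : exists j, i != j.
    have [->|ne] := eqVneq i (Ordinal k_gt0); first by exists (Ordinal k_ge2).
    by exists (Ordinal k_gt0).
  have csij : cs i != cs j.
    by rewrite -subr_eq0 -normr_gt0; exact: lt_le_trans (min_dist_le ocs ij).
  have [y yb yx] := boundary_near dot_norm (@cell_voronoi _ _ _ _ _ _ xi) csij.
  exists y => //; rewrite /closed_ball_ /= distrC.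
  have d0 : 0 < `|cs j - cs i| by rewrite normr_gt0 subr_eq0 eq_sym.
  have := sqd_lip xM (csM j) (csM i) => h.
  by rewrite -(ler_pM2l d0); lra.
have B2 := min_dist_le2M ocs; have p1 := p_min_le1 ocs; have p0 := p_min_ge0.
have -> : B * pm / (128 * M ^+ 2) * (2 * M) = B * pm / (64 * M).
  by field; rewrite gt_eqF.
rewrite ltr_pdivrMr ?mulr_gt0//.
have : B * pm <= 2 * M * 1 by rewrite ler_pM// ltW.
lra.
Qed.

End margin.

(** * The variance of a difference of contrasts *)

Section variance.
Context {R : realType} {H : normedModType R}.
Context (M : R) (P : probability (borel H) R).
Hypothesis PM : P (cball M) = 1%E.

(** The variance is P X^2 - (P X)^2. It is computed from its definition by
    integrating over the ball only, X being possibly unbounded elsewhere. *)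
Lemma variance_le_tame (X : H -> R) (b : R) : tame M X ->
  (forall x, `|x| <= M -> `|X x| <= b) ->
  ('V_P[X : borel H -> R] <= (b ^+ 2)%:E)%E.
Proof.
move=> tX Xb; rewrite /variance unlock.
set m := fine _.
have mE : m = E M P X by rewrite /m unlock; exact: E_setT PM _ tX.1.
have tm : tame M (fun x => X x - m) by apply: tameB => //; exact: tame_cst.
have tmm : tame M (fun x => (X x - m) * (X x - m)) by exact: tameM.
rewrite unlock.
rewrite (_ : integral _ _ _ = (E M P (fun x => (X x - m) * (X x - m)))%:E); last first.
  by rewrite -(integral_tame PM tmm); apply: eq_integral.
rewrite lee_fin.
have tXX : tame M (fun x => X x * X x) by exact: tameM.
have -> : E M P (fun x => (X x - m) * (X x - m)) = E M P (fun x => X x * X x) - m ^+ 2.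
  transitivity (E M P (fun x => X x * X x - 2 * m * X x + m ^+ 2)).
    by apply: eq_E => x _; ring.
  rewrite (ED P (tameB tXX (tameZ (2 * m) tX)) (tame_cst M (m ^+ 2))).
  rewrite (EB P tXX (tameZ (2 * m) tX)) (EZ P _ tX) (E_cst PM) -mE; ring.
apply: le_trans (_ : E M P (fun x => X x * X x) <= _); first by rewrite gerBl sqr_ge0.
rewrite -(E_cst PM (b ^+ 2)); apply: le_E => //; first exact: tame_cst.
move=> x xM /=; rewrite -expr2 -real_normK ?num_real// ler_pXn2r ?nnegrE ?Xb//.
by apply: le_trans (Xb x xM).
Qed.
End variance.

(** * Separation of local minimizers *)

Section finite_min.
Lemma finite_min_gt0 (R : realType) (T : Type) (A : set T) (f : T -> R) : finite_set A ->
  (forall a, A a -> 0 < f a) -> exists2 e, 0 < e & forall a, A a -> e <= f a.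
Proof.
have [A0 _|/set0P[a0 Aa0] fA] := eqVneq A set0 => f0.
  by exists 1 => // a; rewrite A0.
have := @finite_image _ _ A f fA.
case/finite_seqP => s sE.
have s0 t : t \in s -> 0 < t.
  move=> ts; have : [set` s] t by [].
  by rewrite -sE => -[a Aa <-]; exact: f0.
have [e e0 es] : exists2 e : R, 0 < e & forall t, t \in s -> e <= t.
  elim: s s0 {sE} => [|t s IH] s0; first by exists 1.
  have [|e e0 es] := IH; first by move=> u us; apply: s0; rewrite inE us orbT.
  exists (Num.min t e); first by rewrite lt_min e0 s0// inE eqxx.
  move=> u; rewrite inE => /orP[/eqP ->|/es eu]; first by rewrite ge_min lexx.
  by rewrite ge_min eu orbT.
exists e => // a Aa; apply: es.
have : (f @` A) (f a) by exists a.
by rewrite sE.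
Qed.
End finite_min.

Section separation.
Context {R : realType} {H : completeNormedModType R} {dot : {dot H for idfun}}.
Hypothesis dot_norm : forall x : H, dot x x = `|x| ^+ 2.
Hypothesis H_sep : separable H.
Context {M r0 : R} {P : probability (borel H) R} {n : nat}.
Hypothesis n_gt0 : (0 < n)%N.
Hypothesis M_gt0 : 0 < M.
Hypothesis r0_gt0 : 0 < r0.
Hypothesis PM : P (cball M) = 1%E.
Local Notation k := n.+1.
Local Notation B := (min_dist k P).
Local Notation pm := (p_min k P).
Local Notation centroid := (@centroid _ _ dot M P).
Local Notation heavy_codebooks := (@heavy_codebooks _ _ dot M P).
Local Notation k_gt0 := (ltn0Sn n).
Local Notation k_ge2 := (n_gt0 : (2 <= k)%N).
Implicit Types c cs : 'I_k -> H.
Context {b : 'I_n -> H} {co : 'I_k -> H}.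
Hypothesis b_opt : optimal n P b.
Hypothesis co_opt : optimal k P co.
Hypothesis co_lt_b : risk P co < risk P b.

Lemma optimal_risk cs : optimal k P cs -> risk P cs = risk P co.
Proof. by move=> ocs; apply/eqP; rewrite eq_le ocs co_opt. Qed.

Lemma local_minimizer_ball c : local_minimizer P c -> risk P c < risk P b -> in_ball M c.
Proof.
move=> lc cb; apply/in_ballE => i.
apply: (centroid_ball dot_norm M_gt0 PM (measurable_cell c i)).
  exact: (cell_mass_gt0 M_gt0 PM n_gt0 b_opt).
exact: (local_minimizer_centroid dot_norm M_gt0 PM k_gt0 lc).
Qed.

Lemma local_minimizer_heavy c (r : R) : local_minimizer P c -> r < risk P b ->
  risk P c <= r -> heavy_codebooks ((risk P b - r) / (4 * M ^+ 2)) c.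
Proof.
move=> lc rb cr i; have cM := local_minimizer_ball lc (le_lt_trans cr rb).
exists (cell c i); split; first exact: measurable_cell.
  rewrite ler_pdivrMr ?mulr_gt0 ?exprn_gt0// mulrC.
  by have := cell_mass_lb M_gt0 PM n_gt0 b_opt i cM; lra.
exact: (local_minimizer_centroid dot_norm M_gt0 PM k_gt0 lc).
Qed.

Lemma optimal_ball cs : optimal k P cs -> in_ball M cs.
Proof.
move=> ocs; apply: local_minimizer_ball; first exact: optimal_local_minimizer.
by rewrite (optimal_risk ocs).
Qed.

Lemma min_dist_gt0 : 0 < B.
Proof.
apply: (@lt_le_trans _ _ ((risk P b - risk P co) / (4 * M))).
  by rewrite divr_gt0 ?subr_gt0// mulr_gt0.
apply: lb_le_inf.
  by exists (`|co ord0 - co ord_max|), co, ord0, ord_max; split => //;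
    rewrite -val_eqE /= eq_sym -lt0n.
move=> _ [cs [i [j [ocs ij ->]]]].
rewrite ler_pdivrMr ?mulr_gt0// mulrC.
have := centers_sep_lb M_gt0 PM n_gt0 b_opt (optimal_ball ocs) ij.
by rewrite (optimal_risk ocs); lra.
Qed.

Lemma p_min_gt0 : 0 < pm.
Proof.
have M4 : 0 < 4 * M ^+ 2 by rewrite mulr_gt0// exprn_gt0.
apply: (@lt_le_trans _ _ ((risk P b - risk P co) / (4 * M ^+ 2))).
  by rewrite divr_gt0 ?subr_gt0.
apply: lb_le_inf; first by exists (fine (P (voronoi co ord0))), co, ord0.
move=> _ [cs [i [ocs ->]]].
rewrite ler_pdivrMr// mulrC.
have := cell_mass_lb M_gt0 PM n_gt0 b_opt i (optimal_ball ocs).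
rewrite (optimal_risk ocs) => h.
have : prob P (cell cs i) <= prob P (voronoi cs i).
  apply: le_prob; [exact: measurable_cell|by apply: closed_borel; exact: voronoi_closed|].
  exact: cell_voronoi.
by rewrite -(ler_pM2l M4) /prob => h2; rewrite /prob in h; lra.
Qed.

Hypothesis pmP : forall t, 0 <= t <= r0 ->
  p_margin k P t <= B * pm / (128 * M ^+ 2) * t.

Local Notation r := (B * r0 / (4 * Num.sqrt 2 * M)).

Lemma radius_gt0 : 0 < r.
Proof.
have B0 := min_dist_gt0.
by rewrite divr_gt0 ?mulr_gt0 ?sqrt2_gt0.
Qed.

Lemma local_loss_ge cs c : optimal k P cs -> in_ball M c -> codebook_norm (c - cs) <= r ->
  7 / 8 * pm * codebook_norm (c - cs) ^+ 2 <= loss P c cs.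
Proof.
exact: (loss_ge dot_norm M_gt0 r0_gt0 PM k_ge2 optimal_ball min_dist_gt0 pmP).
Qed.

Lemma local_minimizer_close cs c : optimal k P cs -> local_minimizer P c ->
  risk P c < risk P b -> codebook_norm (c - cs) <= r -> c = cs.
Proof.
move=> ocs lc cb cr; apply: (stationary_close dot_norm M_gt0 r0_gt0 PM k_ge2 optimal_ball min_dist_gt0 pmP) => //.
- exact: p_min_gt0.
- exact: local_minimizer_ball.
- exact: (local_minimizer_centroid dot_norm M_gt0 PM k_gt0 lc).
Qed.

Lemma optimal_finite : finite_set (optimal k P).
Proof.
have M4 : 0 < 4 * M ^+ 2 by rewrite mulr_gt0// exprn_gt0.
have d0 : 0 < (risk P b - risk P co) / (4 * M ^+ 2) by rewrite divr_gt0 ?subr_gt0.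
apply: (heavy_separated_finite dot_norm M_gt0 PM H_sep k_gt0 d0 radius_gt0).
  move=> c oc; apply: local_minimizer_heavy => //.
  exact: optimal_local_minimizer.
move=> c c' oc oc' /ltW; apply: local_minimizer_close => //; first exact: optimal_local_minimizer.
by rewrite (optimal_risk oc).
Qed.

(** The radius r is that of the local inequality, so on the spheres that
    bound this region the loss is at least 7 / 8 pm r^2. *)
Definition outside c := forall cs, optimal k P cs -> r <= codebook_norm (c - cs).

Lemma outside_nonoptimal c : outside c -> ~ optimal k P c.
Proof.
move=> oc copt; have := oc _ copt; rewrite leNgt => /negP; apply.
have -> : codebook_norm (c - c) = 0.
  by rewrite subrr /codebook_norm big1 ?sqrtr0// => i _; rewrite normr0 expr0n.
exact: radius_gt0.
Qed.

Lemma outside_limit c :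
  (forall e : R, 0 < e -> exists2 c', outside c' & codebook_norm (c' - c) < e) ->
  outside c.
Proof.
move=> h cs ocs; apply/ler_addgt0Pr => e e0; have [c' oc' cc'] := h e e0.
apply: le_trans (oc' _ ocs) _; apply: le_trans (ler_dist_codebook_norm _ c _) _.
by rewrite addrC lerD2l ltW.
Qed.

Definition spurious_losses : set R := [set l | exists c cs,
  [/\ (local_minimizer P `\` optimal k P) c, optimal k P cs & l = loss P c cs]].

(** Local minimizers of risk at most the midpoint rr are heavy codebooks and,
    when they are not optimal, lie in the outer region by
    [local_minimizer_close]. Over the heavy codebooks of the outer region the
    risk attains a minimum, at a codebook that is not optimal. *)
Lemma spurious_losses_lb : exists2 e : R, 0 < e & forall l, spurious_losses l -> e <= l.
Proof.
pose rr := (risk P b + risk P co) / 2.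
have rb : rr < risk P b by have := co_lt_b; rewrite /rr; lra.
have cr : risk P co < rr by have := co_lt_b; rewrite /rr; lra.
pose d := (risk P b - rr) / (4 * M ^+ 2).
have d0 : 0 < d by rewrite divr_gt0 ?subr_gt0// mulr_gt0// exprn_gt0.
pose A := [set c | heavy_codebooks d c /\ outside c].
have inA c : (local_minimizer P `\` optimal k P) c -> risk P c <= rr -> A c.
  move=> [lc nc] crr; split; first exact: local_minimizer_heavy.
  move=> cs ocs; rewrite leNgt; apply/negP => /ltW h; apply: nc.
  by rewrite (local_minimizer_close ocs lc (le_lt_trans crr rb) h).
have [e e0 eA] : exists2 e : R, 0 < e & forall c, A c -> e <= risk P c - risk P co.
  have [A0|/set0P A0] := eqVneq A set0; first by exists 1 => // c; rewrite A0.
  have [|c [cM cA cmin]] := @heavy_min _ _ _ dot_norm M P M_gt0 PM H_sep _ d A k_gt0 d0 A0.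
    by move=> c [].
  have oc : outside c.
    by apply: outside_limit => e /cA[c' [_ oc'] ?]; exists c'.
  have := outside_nonoptimal oc; move=> /existsNP[c' /negP]; rewrite -ltNge => c'c.
  exists (risk P c - risk P co) => [|c'' /cmin h]; last by rewrite lerD2r.
  by rewrite subr_gt0; apply: le_lt_trans c'c; exact: co_opt.
exists (Num.min e (rr - risk P co)); first by rewrite lt_min e0 subr_gt0.
move=> _ [c [cs [lc ocs ->]]]; rewrite /loss (optimal_risk ocs).
have [crr|/ltW crr] := leP (risk P c) rr.
  by rewrite ge_min eA//; exact: inA.
by rewrite ge_min lerD2r crr orbT.
Qed.

Hypothesis H_nontrivial : exists y : H, y != 0.
Hypothesis b_ball : in_ball M b.

Lemma far_spurious : spurious_losses (risk P b - risk P co).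
Proof.
have [y y0] := H_nontrivial.
have [c lc cb] := far_local_minimizer M_gt0 PM n_gt0 y0 b_opt b_ball.
exists c, co; split => //; last by rewrite /loss cb.
split => // oc; have := oc co; rewrite cb leNgt.
by rewrite co_lt_b.
Qed.

Local Notation eps := (inf spurious_losses).

Lemma eps_gt0 : 0 < eps.
Proof.
have [e e0 h] := spurious_losses_lb; apply: lt_le_trans e0 _.
by apply: lb_le_inf => //; exists (risk P b - risk P co); exact: far_spurious.
Qed.

Lemma eps_le l : spurious_losses l -> eps <= l.
Proof.
by apply: ge_inf; have [e _ h] := spurious_losses_lb; exists e.
Qed.

(** On its way to the centroids the codebook would cross a sphere of radius
    r around an optimal one, where the loss is too large, although the risk
    decreases along the path. *)
Lemma lloyd_outside c m : in_ball M c -> in_ball M m -> outside c ->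
  risk P c < risk P co + pm / 2 * r ^+ 2 ->
  (forall i, centroid (cell c i) (m i)) -> outside m.
Proof.
move=> /in_ballE cM /in_ballE mM oc cr cm cs ocs; rewrite leNgt; apply/negP => mr.
pose p (s : R) : 'I_k -> H := fun i => c i + s *: (m i - c i).
pose f s := codebook_norm (p s - cs).
have pB s t : p s - p t = (fun i => (s - t) *: (m i - c i)).
  apply/funext => i.
  change (c i + s *: (m i - c i) - (c i + t *: (m i - c i)) = (s - t) *: (m i - c i)).
  by rewrite opprD addrACA subrr add0r scalerBl.
have flip s t : f s <= f t + `|s - t| * codebook_norm (m - c).
  rewrite /f [X in _ <= X]addrC; apply: le_trans (ler_dist_codebook_norm _ (p t) _) _.
  by rewrite pB codebook_norm_scale.
(* f is Lipschitz, so it takes the intermediate value r *)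
have fcont : {within `[0, 1], continuous f}.
  apply: continuous_subspaceT => s; apply/cvgrPdist_lt => e e0.
  have K0 : 0 < codebook_norm (m - c) + 1 by rewrite ltr_wpDl// codebook_norm_ge0.
  near=> t.
  have st : `|s - t| < e / (codebook_norm (m - c) + 1).
    by near: t; apply: cvgr_dist_lt; rewrite ?divr_gt0//; exact: cvg_id.
  rewrite ltr_pdivlMr// in st.
  have h1 := flip s t; have h2 := flip t s; rewrite (distrC t) in h2.
  have h3 := normr_ge0 (s - t).
  by rewrite ltr_norml; apply/andP; split; lra.
have f0 : f 0 = codebook_norm (c - cs).
  by congr codebook_norm; apply/funext => i; rewrite /p /=; congr (_ - _); rewrite scale0r addr0.
have f1 : f 1 = codebook_norm (m - cs).
  by congr codebook_norm; apply/funext => i; rewrite /p /=; congr (_ - _); rewrite scale1r addrC subrK.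
have f0r : r <= f 0 by rewrite f0 oc.
have f1r : f 1 < r by rewrite f1.
have [|s] := @IVT R f 0 1 r ler01 fcont.
  by rewrite ge_min le_max f0r (ltW f1r) orbT.
rewrite in_itv /= => s01 fs.
have psM : in_ball M (p s).
  apply/in_ballE => i; have /andP[s0 s1] := s01.
  have -> : p s i = (1 - s) *: c i + s *: m i.
    by rewrite /p scalerBr scalerBl scale1r addrA addrAC.
  apply: le_trans (ler_normD _ _) _; rewrite !normrZ !ger0_norm ?subr_ge0//.
  have : (1 - s) * `|c i| <= (1 - s) * M by rewrite ler_wpM2l ?subr_ge0.
  have : s * `|m i| <= s * M by rewrite ler_wpM2l.
  lra.
have := local_loss_ge ocs psM; rewrite -/(f s) fs lexx => /(_ isT).
have := lloyd_path dot_norm M_gt0 PM k_gt0 s01 cm; rewrite -/(p s) /loss (optimal_risk ocs).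
have := p_min_gt0; have : 0 < r ^+ 2 by rewrite exprn_gt0// radius_gt0.
move: (r ^+ 2) cr => q cr q0 p0 h1 h2.
have := mulr_gt0 p0 q0; lra.
Unshelve. all: by end_near. Qed.

(** Otherwise minimize the risk over the heavy codebooks of the outer
    region. By [lloyd_outside] the minimizer x beats all codebooks of the outer
    region near it, in the ball or not. It is not on a bounding sphere, its
    loss being too small; so it is a local minimizer, not optimal, and its loss
    is at least eps. *)
Lemma outside_loss c : in_ball M c -> outside c ->
  Num.min eps (pm / 2 * r ^+ 2) <= risk P c - risk P co.
Proof.
move=> cM oc; rewrite leNgt; apply/negP; rewrite lt_min => /andP[ce cr].
have cb : risk P c < risk P b.
  by have := eps_le far_spurious; lra.
have cr' c' : risk P c' <= risk P c -> risk P c' < risk P co + pm / 2 * r ^+ 2 by lra.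
pose d := (risk P b - risk P c) / (4 * M ^+ 2).
have d0 : 0 < d by rewrite divr_gt0 ?subr_gt0// mulr_gt0// exprn_gt0.
pose A := [set c' | heavy_codebooks d c' /\ outside c'].
have stay c' : in_ball M c' -> outside c' -> risk P c' <= risk P c ->
    exists2 m, A m & risk P m <= risk P c'.
  move=> c'M oc' c'c.
  have [m hm cm] := lloyd_heavy dot_norm M_gt0 PM n_gt0 b_opt cb c'M c'c.
  exists m; last exact: lloyd_risk cm.
  split => //; apply: lloyd_outside cm => //; last exact: cr'.
  exact: (heavy_in_ball dot_norm M_gt0 PM d0 hm).
have [m Am mc] := stay c cM oc (lexx _).
have A0 : A !=set0 by exists m.
have [|x [xM xA xmin]] := @heavy_min _ _ _ dot_norm M P M_gt0 PM H_sep _ d A k_gt0 d0 A0.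
  by move=> c' [].
have ox : outside x by apply: outside_limit => e /xA[c' [_ oc'] ?]; exists c'.
have xc : risk P x <= risk P c := le_trans (xmin _ Am) mc.
have xfar cs : optimal k P cs -> 0 < codebook_norm (x - cs) - r.
  move=> ocs; rewrite subr_gt0 lt_neqAle ox// andbT; apply/eqP => xr.
  have := local_loss_ge ocs xM; rewrite -xr lexx => /(_ isT).
  rewrite /loss (optimal_risk ocs); have := cr' _ xc.
  have := mulr_gt0 p_min_gt0 (exprn_gt0 2 radius_gt0); lra.
have [eta eta0 etaP] := finite_min_gt0 optimal_finite xfar.
(* x may have competitors outside the ball: retract them first *)
have lx : local_minimizer P x.
  exists eta => // c' c'x.
  have [c'' [c''M c''r c''z]] := ball_retract_codebook dot_norm M_gt0 PM k_gt0 c'.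
  have c''x : codebook_norm (x - c'') < eta.
    apply: le_lt_trans c'x; rewrite (codebook_normB x) /codebook_norm ler_sqrt ?sumsq_ge0//.
    apply: ler_sum => i _; rewrite ler_pXn2r ?nnegrE//.
    change (is_true (`|c'' i - x i| <= `|c' i - x i|)).
    by apply: c''z; move/in_ballE : xM.
  have oc'' : outside c''.
    move=> cs ocs; have := etaP _ ocs; have := ler_dist_codebook_norm x c'' cs; lra.
  apply: le_trans c''r; have [c''c|/ltW c''c] := leP (risk P c'') (risk P c).
    have [m' Am' m'c] := stay _ c''M oc'' c''c.
    exact: le_trans (xmin _ Am') m'c.
  exact: le_trans xc c''c.
have : eps <= risk P x - risk P co.
  by apply: eps_le; exists x, co; split => //; split => //; exact: outside_nonoptimal.
lra.
Qed.

(** Close to cn the local inequality applies, and 2 / pm is at most kappa0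
    because B and r0 are at most 2 M. Far from it |c - cn|^2 is at most 4 k M^2
    and [outside_loss] bounds the loss from below. *)
Lemma norm_le_loss c cn : in_ball M c -> nearest_optimal P c cn ->
  codebook_norm (c - cn) ^+ 2 <=
  4 * k%:R * M ^+ 2 * Num.max (1 / eps) (64 * M ^+ 2 / (pm * B ^+ 2 * r0 ^+ 2)) * loss P c co.
Proof.
move=> cM [ocn cnmin]; have M0 := M_gt0; have B0 := min_dist_gt0; have p0 := p_min_gt0.
have e0 := eps_gt0; have s0 := sqrt2_gt0 R.
have M20 : 0 < M ^+ 2 by rewrite exprn_gt0.
have B20 : 0 < B ^+ 2 by rewrite exprn_gt0.
have r20 : 0 < r0 ^+ 2 by rewrite exprn_gt0.
have k0 : 1 <= k%:R :> R by rewrite ler1n.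
set q := pm * B ^+ 2 * r0 ^+ 2.
have q0 : 0 < q by rewrite !mulr_gt0.
(* this is where the second term of kappa0 comes from *)
have rE : pm / 2 * r ^+ 2 = q / (64 * M ^+ 2).
  have -> : r ^+ 2 = B ^+ 2 * r0 ^+ 2 / (32 * M ^+ 2).
    rewrite !exprMn exprVn !exprMn sqr_sqrtr ?ler0n//.
    by field; rewrite gt_eqF.
  by rewrite /q; field; rewrite gt_eqF.
set mx := Num.max _ _.
have mx1 : 1 / eps <= mx by rewrite le_max lexx.
have mx2 : 64 * M ^+ 2 / q <= mx by rewrite le_max lexx orbT.
have l0 : 0 <= loss P c co by rewrite subr_ge0; exact: co_opt.
have N4 : codebook_norm (c - cn) ^+ 2 <= 4 * k%:R * M ^+ 2.
  rewrite sqr_codebook_norm.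
  apply: le_trans (_ : \sum_(i < k) (2 * M) ^+ 2 <= _).
    apply: ler_sum => i _; rewrite ler_pXn2r ?nnegrE ?mulr_ge0 ?(ltW M0)//.
    apply: le_trans (ler_normB _ _) _.
    move/in_ballE : cM => /(_ i); have /in_ballE /(_ i) := optimal_ball ocn; lra.
  by rewrite sumr_const card_ord -[X in X <= _]mulr_natr exprMn; lra.
have [near|far] := leP (codebook_norm (c - cn)) r.
  have := local_loss_ge ocn cM near; rewrite /loss (optimal_risk ocn) -/(loss P c co) => h.
  apply: (@le_trans _ _ (2 / pm * loss P c co)).
    rewrite mulrAC ler_pdivlMr//.
    have : 0 <= pm * codebook_norm (c - cn) ^+ 2 by rewrite mulr_ge0 ?sqr_ge0 ?ltW.
    lra.
  rewrite ler_wpM2r//.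
  apply: le_trans (_ : 4 * k%:R * M ^+ 2 * (64 * M ^+ 2 / q) <= _); last first.
    by rewrite ler_wpM2l// !mulr_ge0 ?ler0n// ltW.
  have B2 := min_dist_le2M k_ge2 optimal_ball co_opt.
  have r2 := margin_radius_lt dot_norm M_gt0 PM k_ge2 optimal_ball min_dist_gt0 pmP co_opt.
  have BB : B ^+ 2 <= 4 * M ^+ 2.
    have -> : 4 * M ^+ 2 = (2 * M) ^+ 2 by ring.
    by rewrite ler_pXn2r ?nnegrE ?mulr_ge0 ?(ltW B0) ?(ltW M0).
  have rr : r0 ^+ 2 <= 4 * M ^+ 2.
    have -> : 4 * M ^+ 2 = (2 * M) ^+ 2 by ring.
    by rewrite ler_pXn2r ?nnegrE ?mulr_ge0 ?(ltW r0_gt0) ?(ltW M0) ?(ltW r2).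
  have key : B ^+ 2 * r0 ^+ 2 <= 128 * k%:R * (M ^+ 2 * M ^+ 2).
    apply: (@le_trans _ _ (4 * M ^+ 2 * (4 * M ^+ 2))).
      by apply: ler_pM => //; exact: ltW.
    have := mulr_gt0 M20 M20; nra.
  rewrite ler_pdivrMr//.
  have -> : 4 * k%:R * M ^+ 2 * (64 * M ^+ 2 / q) * pm =
      256 * k%:R * (M ^+ 2 * M ^+ 2) * pm / q by ring.
  rewrite ler_pdivlMr// /q.
  have := ler_wpM2l (ltW p0) key; lra.
have oc : outside c by move=> cs ocs; apply: le_trans (ltW far) (cnmin _ ocs).
have := outside_loss cM oc; rewrite rE -/(loss P c co) => h.
have l1 : 1 <= mx * loss P c co.
  move: h; rewrite ge_min => /orP[h|h].
    apply: le_trans (_ : 1 / eps * loss P c co <= _); last by rewrite ler_wpM2r.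
    by rewrite mulrAC mul1r ler_pdivlMr// mul1r.
  apply: le_trans (_ : 64 * M ^+ 2 / q * loss P c co <= _); last by rewrite ler_wpM2r.
  rewrite mulrAC ler_pdivlMr// mul1r; move: h; rewrite ler_pdivrMr ?mulr_gt0//.
  by rewrite [_ * loss _ _ _]mulrC.
apply: le_trans N4 _; rewrite -[X in _ <= X]mulrA ler_peMr//.
by rewrite !mulr_ge0 ?ler0n// ltW.
Qed.

End separation.

(** * The theorem *)

Theorem proposition2p2 (R : realType) (H : completeNormedModType R)
    (dot : {dot H for idfun})
    (dot_norm : forall x : H, dot x x = `|x| ^+ 2)
    (H_separable : separable H)
    (k : nat) (k_ge2 : (2 <= k)%N)
    (M r0 : R) (M_gt0 : 0 < M) (r0_gt0 : 0 < r0)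
    (P : probability (borel H) R)
    (supp_gtk : ([set: 'I_k.+1] #<= measure_support P)%card)
    (P_margin : margin_condition k M r0 P) :
  let B := min_dist k P in
  let pm := p_min k P in
  [/\ (forall cstar c : 'I_k -> H, optimal k P cstar -> in_ball M c ->
         codebook_norm (c - cstar) <= B * r0 / (4 * Num.sqrt 2 * M) ->
         loss P c cstar >= pm / 2 * codebook_norm (c - cstar) ^+ 2),
      finite_set (optimal k P)
    & exists eps : R,
      [/\ 0 < eps,
          eps_separated k eps P
        & let kappa0 := 4 * k%:R * M ^+ 2 *
            Num.max (1 / eps) (64 * M ^+ 2 / (pm * B ^+ 2 * r0 ^+ 2)) in
          forall c cstar_c cstar : 'I_k -> H,
            in_ball M c -> nearest_optimal P c cstar_c -> optimal k P cstar ->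
            ((1 / (16 * M ^+ 2))%:E *
               'V_P[fun x => (contrast c x - contrast cstar_c x)%R]
             <= (codebook_norm (c - cstar_c) ^+ 2)%:E)%E /\
            codebook_norm (c - cstar_c) ^+ 2 <= kappa0 * loss P c cstar]].
Proof.
move=> B pm; have [supp_ball margin] := P_margin.
have PM : P (cball M) = 1%E.
  have Pc : P (~` cball M) = 0%E.
    apply: support_full => //; first exact: cball_closed.
    by move=> x /supp_ball; rewrite /closed_ball_ /= sub0r normrN.
  have mc := measurable_cball (H := H) M.
  by rewrite -[cball M]setCK probability_setC ?Pc ?sube0//; exact: measurableC.
(* n = k - 1 centres are compared with k; the support contains k + 1 points f i *)
case: k k_ge2 supp_gtk {P_margin} @B @pm margin => // n n_gt0 /pcard_leP[f] B pm margin.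
have fP i : measure_support P (f i) := @funS _ _ _ _ f i Logic.I.
have finj : injective f by move=> i j; apply: (@inj _ _ [set: 'I_n.+2] f); rewrite inE.
have [b b_opt b_ball] : exists2 b : 'I_n -> H, optimal n P b & in_ball M b.
  by apply: (optimal_exists dot_norm M_gt0 PM H_separable finj fP) => //; rewrite ltnW.
have [co co_opt _] : exists2 c : 'I_n.+1 -> H, optimal n.+1 P c & in_ball M c.
  exact: (optimal_exists dot_norm M_gt0 PM H_separable finj fP).
have [i fb] := injection_avoids b finj (leqnSn n.+1).
have co_lt_b : risk P co < risk P b.
  exact: le_lt_trans (co_opt _) (risk_extend_lt M_gt0 PM n_gt0 (fP i) fb).
have H_nontrivial : exists y : H, y != 0.
  exists (f ord0 - f ord_max); rewrite subr_eq0.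
  by apply/eqP => /finj /(congr1 val).
have pm_gt0 := p_min_gt0 dot_norm n_gt0 M_gt0 PM b_opt co_opt co_lt_b.
split.
- move=> cs c ocs cM cr.
  have := local_loss_ge dot_norm n_gt0 M_gt0 r0_gt0 PM b_opt co_opt co_lt_b margin ocs cM cr.
  by have := mulr_ge0 (ltW pm_gt0) (sqr_ge0 (codebook_norm (c - cs))); rewrite -/pm; lra.
- exact: (optimal_finite dot_norm H_separable n_gt0 M_gt0 r0_gt0 PM b_opt co_opt co_lt_b margin).
exists (inf (spurious_losses (P := P) (n := n))); split => //.
  exact: (eps_gt0 dot_norm H_separable n_gt0 M_gt0 r0_gt0 PM b_opt co_opt co_lt_b margin).
move=> kappa0 c cn cs cM cnn ocs; split; last first.
  have -> : loss P c cs = loss P c co by rewrite /loss (optimal_risk co_opt ocs).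
  exact: (norm_le_loss dot_norm H_separable n_gt0 M_gt0 r0_gt0 PM b_opt co_opt co_lt_b margin).
have cnM : in_ball M cn := optimal_ball dot_norm n_gt0 M_gt0 PM b_opt co_opt co_lt_b cnn.1.
have tX : tame M (fun x : H => contrast c x - contrast cn x).
  by apply: tameB; exact: tame_contrast.
have Xb (x : H) : `|x| <= M -> `|contrast c x - contrast cn x| <= 4 * M * codebook_norm (c - cn).
  move=> xM; rewrite ler_norml; apply/andP; split.
    have := contrast_lip M_gt0 (ltn0Sn n) cnM cM xM; rewrite codebook_normB; lra.
  exact: contrast_lip.
have := variance_le_tame PM tX Xb => hV.
have c0 : (0 <= (1 / (16 * M ^+ 2))%:E)%E.
  by rewrite lee_fin divr_ge0// mulr_ge0// sqr_ge0.
apply: le_trans (lee_wpmul2l c0 hV) _.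
rewrite -EFinM lee_fin le_eqVlt; apply/orP; left; apply/eqP.
by field; rewrite gt_eqF.
Qed.
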